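(* Let $(V,E)$ be the Cayley tree of order $d$ and let $s$ be an integer with $s>\frac{d+1}{2}$. Let $\eta\in\Omega$ be any configuration such that the set of occupied sites $\mathcal O(\eta):=\{i\in V:|\eta_i|=1\}$ contains a rooted tree of order $s$. Then there exists a critical repulsion strength $\beta_c(d,s)\in(0,\infty)$ (depending only on $d$ and $s$) such that for all $\beta>\beta_c(d,s)$ there exists a time $t_c(\beta,d,s)\in(0,\infty)$ (depending only on $\beta,d,s$) such that the time-evolved intermediate measure $\mu^{\#}_{\beta,\lambda,t}$ is essentially-discontinuous at $\eta$ for all times $t\ge t_c(\beta,d,s)$ and all activities $\lambda>0$.
   Context: The Cayley tree of order $d$ is the infinite tree $(V,E)$ in which each vertex has exactly $d+1$ neighbours. A rooted tree of order $s$ contained in a set $\mathcal O\subset V$ means a (connected, infinite) subtree of $(V,E)$ with vertex set in $\mathcal O$ and a distinguished root, in which each vertex (including the root) has exactly $s$ children, i.e. $s$ neighbours in the subtree that are further away from the root. $\Omega=\{-1,0,1\}^V$ carries the product $\sigma$-algebra and product topology; $\sigma_\Lambda$ denotes the restriction map $\omega\mapsto\omega_\Lambda=(\omega_i)_{i\in\Lambda}$, $\mathcal F_\Lambda$ the $\sigma$-algebra generated by $\sigma_\Lambda$, and $\Lambda\Subset V$ means $\Lambda$ is a finite subset. A function is local if it is $\mathcal F_\Lambda$-measurable for some $\Lambda\Subset V$. Soft-core Widom-Rowlinson model (zero magnetic field), $\beta>0$ (repulsion), $\lambda>0$ (activity): for $\Lambda\Subset V$, $$\gamma_\Lambda(\sigma_\Lambda=\omega_\Lambda\mid\eta_{\Lambda^c})=\frac1{Z_\Lambda(\eta_{\Lambda^c})}\exp\Big(-\beta\sum_{\{i,j\}\in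 E,\{i,j\}\cap\Lambda\ne\emptyset}1_{\{\tilde\omega_i\tilde\omega_j=-1\}}\Big)\prod_{i\in\Lambda}\lambda^{\omega_i^2},\qquad \tilde\omega=\omega_\Lambda\eta_{\Lambda^c}.$$ Gibbs measures of the model are probability measures $\mu$ with $\mu=\mu\gamma_\Lambda$ for all $\Lambda\Subset V$. A probability measure $\mu$ on $\Omega$ is a tree-indexed Markov chain if for each oriented edge $ij$ one has $\mu(\sigma_j=x\mid\mathcal F_{(-\infty,ij)})=\mu(\sigma_j=x\mid\mathcal F_{\{i\}})$ $\mu$-a.s. for all $x$, where $(-\infty,ij)$ is the set of vertices $k$ whose self-avoiding path to $i$ does not contain $j$. The intermediate measure $\mu^{\#}_{\beta,\lambda}$ is the unique Gibbs measure of the model that is a tree-indexed Markov chain, invariant under all tree automorphisms, and invariant under the spin flip $\omega\mapsto-\omega$. Concretely, let $\xi=\xi_{\beta,\lambda}$ be the unique positive solution of $x=\lambda\big(\frac{1+(1+e^{-\beta})x}{1+2x}\big)^d$; then $\mu^{\#}_{\beta,\lambda}$ is the homogeneous tree-indexed Markov chain with transition matrix $P$ given by $P(s,s)=\frac{\xi}{1+(1+e^{-\beta})\xi}$, $P(s,-s)=\frac{e^{-\beta}\xi}{1+(1+e^{-\beta})\xi}$, $P(s,0)=\frac{1}{1+(1+e^{-\beta})\xi}$ for $s\in\{-1,1\}$, $P(0,\pm1)=\frac{\xi}{1+2\xi}$, $P(0,0)=\frac1{1+2\xi}$ (here $s$ denotes a sign), with the $P$-invariant distribution as single-site marginal. Time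 evolution: for $t\ge0$, $\mu_t$ is the image of $\mu$ under the product kernel that acts independently at each site by $$p_t(\omega,\eta)=\tfrac12(1+e^{-2t})1_{\{\omega=\eta\ne0\}}+\tfrac12(1-e^{-2t})1_{\{\omega\eta=-1\}}+1_{\{\omega=\eta=0\}},\qquad \omega,\eta\in\{-1,0,1\}.$$ $\mu^{\#}_{\beta,\lambda,t}$ is the time-evolved measure started from $\mu^{\#}_{\beta,\lambda}$. Essential discontinuity: a measure $\mu_t$ is essentially-discontinuous at $\eta\in\Omega$ if there exist a local function $f$ and $\Lambda_0\Subset V$ such that $$\limsup_{\Lambda\nearrow V}\ \sup_{\xi^1,\xi^2\in\Omega,\ \Delta:\Lambda\subset\Delta\Subset V}\big|\mu_t(f\mid\eta_{\Lambda\setminus\Lambda_0}\xi^1_{\Delta\setminus\Lambda})-\mu_t(f\mid\eta_{\Lambda\setminus\Lambda_0}\xi^2_{\Delta\setminus\Lambda})\big|>0,$$ where $\mu_t(f\mid\zeta_A)$ is the elementary conditional expectation of $f$ given $\{\sigma_A=\zeta_A\}$ and the limsup is along finite $\Lambda$ directed by inclusion. *)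

(* Defs.v *)
From HB Require Import structures.
From mathcomp Require Import all_boot all_order all_algebra finmap.
From mathcomp Require Import all_classical all_reals all_analysis.

Set Implicit Arguments.
Unset Strict Implicit.
Unset Printing Implicit Defensive.

Import Order.TTheory GRing.Theory Num.Theory.
Import numFieldNormedType.Exports.

Local Open Scope classical_set_scope.
Local Open Scope ring_scope.

(** * Spins and configurations *)

Inductive spin : Type := Minus | Zero | Plus.

Definition spin_code (x : spin) : option bool :=
  match x with Minus => Some false | Zero => None | Plus => Some true end.

Definition spin_decode (c : option bool) : spin :=
  match c with Some false => Minus | None => Zero | Some true => Plus end.

Lemma spin_codeK : cancel spin_code spin_decode.
Proof. by case. Qed.

#[warnings="-redundant-canonical-projection"]
HB.instance Definition _ := Finite.copy spin (can_type spin_codeK).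
HB.instance Definition _ := isPointed.Build spin Zero.

Definition spin_val (x : spin) : int :=
  match x with Minus => -1 | Zero => 0 | Plus => 1 end.

Definition flip (x : spin) : spin :=
  match x with Minus => Plus | Zero => Zero | Plus => Minus end.

Definition coord_events (V : choiceType) (A : set V) : set_system (V -> spin) :=
  [set B | exists i x, A i /\ B = [set w | w i = x]].

(** [{-1,0,1}^V] with the product sigma-algebra. *)
Notation config V := (g_sigma_algebraType (@coord_events V setT)).

(** The sigma-algebra generated by the spins in [A]. *)
Definition sigma_field (V : choiceType) (A : set V) : set_system (config V) :=
  <<s coord_events A >>.

Definition agree_on (V : choiceType) (L : {fset V}) (eta : config V) :
  set (config V) := [set w | forall i, i \in L -> w i = eta i].

(** * Trees *)

Definition is_tree (V : choiceType) (E : rel V) : Prop :=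
  [/\ symmetric E, irreflexive E,
      forall x y, exists2 p, path E x p & last x p = y
    & forall c : seq V, ucycle E c -> (size c <= 2)%N].

Definition cayley_tree (d : nat) (V : choiceType) (E : rel V) : Prop :=
  [/\ is_tree E, infinite_set [set: V]
    & forall x, exists2 N : {fset V}, #|` N| = d.+1 & N =i E x].

(** [y] has a strictly larger graph distance from [r] than [x]. *)
Definition farther (V : choiceType) (E : rel V) (r x y : V) : Prop :=
  exists p, [/\ path E r p, last r p = x
    & forall q, path E r q -> last r q = y -> (size p < size q)%N].

(** Edges of a subtree of a tree are all the edges between its vertices, so a
    subtree is given by its vertex set [T]. *)
Definition rooted_subtree (s : nat) (V : choiceType) (E : rel V)
    (T : set V) (r : V) : Prop :=
  [/\ T r,
      forall x, T x -> exists p,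
        [/\ path E r p, last r p = x & forall y, y \in p -> T y]
    & forall x, T x -> exists2 C : {fset V}, #|` C| = s &
        forall y, y \in C <-> [/\ T y, E x y & farther E r x y]].

Definition contains_rooted_tree (s : nat) (V : choiceType) (E : rel V)
    (O : set V) : Prop :=
  exists T r, rooted_subtree s E T r /\ T `<=` O.

Definition occupied (V : choiceType) (eta : config V) : set V :=
  [set i | `|spin_val (eta i)| = 1].

(** The past [(-oo, ij)] of an oriented edge: the vertices whose self-avoiding
    path to [i] avoids [j]. *)
Definition past (V : choiceType) (E : rel V) (i j : V) : set V :=
  [set k | exists p,
    [/\ path E k p, last k p = i, uniq (k :: p) & j \notin k :: p]].

(** * The soft-core Widom-Rowlinson model *)

Section Model.
Context (R : realType) (V : choiceType) (E : rel V).
Implicit Types (L : {fset V}) (w eta : config V) (mu : probability (config V) R).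

(** Unordered edges touching [L] whose endpoints carry opposite signs. *)
Definition conflicting_edges L w : set {fset V} :=
  [set e | exists i j, [/\ e = [fset i; j]%fset, E i j, (i \in L) || (j \in L)
                         & spin_val (w i) * spin_val (w j) = -1]].

Definition weight (beta lambda : R) L w : R :=
  expR (- beta * (#|` fset_set (conflicting_edges L w)|)%:R) *
  \prod_(i <- L) lambda ^ (spin_val (w i) ^+ 2).

Definition glue L (u : {ffun L -> spin}) eta : config V :=
  fun i => if insub i is Some k then u k else eta i.

Definition gibbs_kernel (beta lambda : R) L (A : set (config V)) eta : R :=
  (\sum_(u : {ffun L -> spin})
      weight beta lambda L (glue u eta) * \1_A (glue u eta)) /
  (\sum_(u : {ffun L -> spin}) weight beta lambda L (glue u eta)).

Definition gibbs_measure (beta lambda : R) mu : Prop :=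
  forall L (A : set (config V)), measurable A ->
    mu A = (\int[mu]_eta (gibbs_kernel beta lambda L A eta)%:E)%E.

(** [g] is a version of the conditional probability of [B] given the
    sub-sigma-algebra [G]. *)
Definition cond_prob_version mu (G : set_system (config V))
    (B : set (config V)) (g : config V -> R) : Prop :=
  [/\ forall Y : set R, measurable Y -> G (g @^-1` Y),
      mu.-integrable setT (EFin \o g)
    & forall A, G A -> (\int[mu]_(w in A) (g w)%:E)%E = mu (A `&` B)].

(** The conditional probabilities of [sigma_j = x] given the past of [ij] and
    given the spin at [i] agree almost surely iff they have a common version,
    since the second sigma-algebra is contained in the first. *)
Definition tree_markov_chain mu : Prop :=
  forall i j x, E i j -> exists g : config V -> R,
    cond_prob_version mu (sigma_field (past E i j)) [set w | w j = x] g /\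
    cond_prob_version mu (sigma_field [set i]) [set w | w j = x] g.

Definition transition_matrix mu (P : spin -> spin -> R) : Prop :=
  forall i j x y, E i j ->
    mu [set w | w i = x /\ w j = y] = (mu [set w | w i = x] * (P x y)%:E)%E.

Definition invariant_marginals mu (P : spin -> spin -> R) : Prop :=
  exists2 alpha : spin -> R,
    forall y, \sum_(x : spin) alpha x * P x y = alpha y &
    forall i x, mu [set w | w i = x] = (alpha x)%:E.

Definition automorphism_invariant mu : Prop :=
  forall phi : V -> V, bijective phi ->
    (forall i j, E (phi i) (phi j) = E i j) ->
    forall A : set (config V), measurable A ->
      mu [set w : config V | A (fun i => w (phi i))] = mu A.

Definition flip_invariant mu : Prop :=
  forall A : set (config V), measurable A ->
    mu [set w : config V | A (fun i => flip (w i))] = mu A.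

Definition transition_xi (beta xi : R) (x y : spin) : R :=
  if x == Zero then
    (if y == Zero then 1 else xi) / (1 + 2 * xi)
  else
    (if y == Zero then 1 else if y == x then xi else expR (- beta) * xi) /
    (1 + (1 + expR (- beta)) * xi).

(** The right-hand side is non-increasing in [x], hence there is exactly one
    positive solution. *)
Definition xi_equation (d : nat) (beta lambda x : R) : Prop :=
  x = lambda * ((1 + (1 + expR (- beta)) * x) / (1 + 2 * x)) ^+ d.

Definition intermediate_measure (d : nat) (beta lambda : R) mu : Prop :=
  [/\ gibbs_measure beta lambda mu, tree_markov_chain mu,
      automorphism_invariant mu, flip_invariant mu
    & exists xi : R, [/\ 0 < xi, xi_equation d beta lambda xi,
        transition_matrix mu (transition_xi beta xi)
      & invariant_marginals mu (transition_xi beta xi)]].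

End Model.

(** * Time evolution *)

Definition flip_prob (R : realType) (t : R) (x y : spin) : R :=
  2^-1 * (1 + expR (- (2 * t))) * ((x == y) && (y != Zero))%:R +
  2^-1 * (1 - expR (- (2 * t))) * (spin_val x * spin_val y == -1)%:R +
  ((x == y) && (y == Zero))%:R.

Definition product_kernel (R : realType) (V : choiceType)
    (p : spin -> spin -> R) (K : R.-pker (config V) ~> (config V)) : Prop :=
  forall w eta (L : {fset V}),
    K w (agree_on L eta) = (\prod_(i <- L) p (w i) (eta i))%:E.

Definition time_evolved (R : realType) (V : choiceType) (t : R)
    (mu mu_t : probability (config V) R) : Prop :=
  exists2 K : R.-pker (config V) ~> (config V), product_kernel (flip_prob t) K &
    forall A : set (config V), measurable A ->
      mu_t A = (\int[mu]_w K w A)%E.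

(** * Essential discontinuity *)

Definition local_function (R : realType) (V : choiceType)
    (f : config V -> R) : Prop :=
  exists L : {fset V}, forall Y : set R, measurable Y ->
    sigma_field [set` L] (f @^-1` Y).

Definition elementary_cond_exp (R : realType) (V : choiceType)
    (mu : probability (config V) R) (f : config V -> R) (B : set (config V)) : R :=
  fine (\int[mu]_(w in B) (f w)%:E) / fine (mu B).

(** [limsup] and [sup] are taken in the extended reals; the [limsup] along the
    finite sets directed by inclusion is the infimum over [M] of the suprema over
    [L] containing [M]. *)
Definition essentially_discontinuous (R : realType) (V : choiceType)
    (mu : probability (config V) R) (eta : config V) : Prop :=
  exists (f : config V -> R) (L0 : {fset V}), local_function f /\
    let cond (L D : {fset V}) (xi : config V) :=
      elementary_cond_exp mu f
        (agree_on (L `\` L0)%fset eta `&` agree_on (D `\` L)%fset xi) in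
    let osc (L : {fset V}) : \bar R :=
      ereal_sup [set z | exists (xi1 xi2 : config V) (D : {fset V}),
        (L `<=` D)%fset /\ z = (`|cond L D xi1 - cond L D xi2|)%:E] in
    (0 < ereal_inf [set ereal_sup [set osc L | L in [set L | (M `<=` L)%fset]]
                   | M in [set: {fset V}]])%E.

(* Main.v *)
(** Occupation is preserved by the dynamics, and given the occupied sites the
    time-0 signs form an Ising model on the tree in which the time-[t] signs act
    as a local field of strength [rho = (1+e^{-2t})/(1-e^{-2t})], which is at
    most 2 for [t >= 1].  Integrating out the leaves of a large ball one layer
    at a time turns the conditional law at the root into a recursion for weight
    ratios [u] of the two signs; crossing an edge replaces [u] by
    [(u + q)/(1 + q u)] with [q = e^{-beta}], whatever [lambda] is.
    In the annulus outside [Lambda] all spins are [b]: since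
    [((u + q)/(1 + q u))^2 >= u] for [1 <= u <= 1/q], the field pushes the ratio
    in favour of [b] up to [Q = 1/q], no matter how weak it is.  Inside [Lambda],
    a vertex of the order-[s] tree gets a factor at least [Q/2] from each of its
    [s] children and loses at most a factor [Q] from each of the [d - s] others
    and a factor 2 from its own field; as [2s - d >= 2], a ratio [Q >= 2^(s+1)] is
    reproduced down to the root, against any configuration elsewhere.  Hence [b = +]
    and [b = -] lead to time-0 magnetizations of opposite sign at the root, and the
    dynamics only multiplies these by [e^{-2t}]. *)
Require Import Defs.
From HB Require Import structures.
From mathcomp Require Import all_boot all_order all_algebra finmap.
From mathcomp Require Import all_classical all_reals all_analysis.
From mathcomp Require Import measurable_realfun.
From mathcomp Require Import ring lra zify.

Set Implicit Arguments.
Unset Strict Implicit.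
Unset Printing Implicit Defensive.

Import Order.TTheory GRing.Theory Num.Theory.
Import numFieldNormedType.Exports.

Local Open Scope classical_set_scope.
Local Open Scope ring_scope.

(** * Distances in a rooted tree *)

Section SimplePaths.
Local Open Scope nat_scope.
Variables (V : eqType) (E : rel V).
Hypotheses (symE : symmetric E) (acyE : forall c : seq V, ucycle E c -> size c <= 2).

(** Cut both paths at the first vertex [z] of [b :: q] lying on [a :: p]: the first path up to [z],
    followed by the second one backwards, is a simple cycle through [x]. Acyclicity bounds its
    length by 2, so it consists of [x] and [z] only, and both first steps are [z]. *)
Lemma simple_paths_eq_head (x a b : V) p q :
  path E x (a :: p) -> path E x (b :: q) ->
  uniq (x :: a :: p) -> uniq (x :: b :: q) ->
  last a p = last b q -> a = b.
Proof.
move=> Ep Eq Up Uq lpq; apply/eqP; apply: contraT => ab.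
have hq : has (mem (a :: p)) (b :: q).
  apply/hasP; exists (last b q); first exact: mem_last.
  by rewrite -lpq; exact: mem_last.
have [z [q1 [q2 [ebq zp nq1]]]] : exists z q1 q2,
    [/\ b :: q = rcons q1 z ++ q2, z \in a :: p & ~~ has (mem (a :: p)) q1].
  by case: (split_find hq) => z q1 q2 zp nq1; exists z, q1, q2.
have [p1 [p2 eap]] : exists p1 p2, a :: p = rcons p1 z ++ p2.
  by case: (path.splitP zp) => p1 p2; exists p1, p2.
have cyc : ucycle E (x :: rcons p1 z ++ rev q1).
  apply/andP; split.
    rewrite /= rcons_cat cat_path last_rcons.
    move: Ep; rewrite eap cat_path => /andP[-> _] /=.
    move: Eq; rewrite ebq cat_path => /andP[+ _].
    rewrite -rev_cons -{2}(last_rcons x q1 z).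
    have -> : x :: q1 = belast x (rcons q1 z) by rewrite belast_rcons.
    by rewrite rev_path (eq_path (e' := E)).
  move: Up; rewrite eap cons_uniq mem_cat negb_or => /andP[/andP[xp _]].
  rewrite cat_uniq => /andP[up _].
  move: Uq; rewrite ebq cons_uniq mem_cat negb_or => /andP[/andP[xq _]].
  rewrite cat_uniq rcons_uniq => /andP[/andP[zq uq] _].
  move: xq; rewrite mem_rcons inE negb_or => /andP[_ xq].
  rewrite cons_uniq mem_cat negb_or xp mem_rev xq cat_uniq up rev_uniq uq !andbT.
  rewrite /= ?andbT; apply/hasPn => y; rewrite mem_rev => yq; apply/negP => yp.
  move/hasPn: nq1 => /(_ y yq) /negP; apply; rewrite /= eap.
  by have := mem_cat y (rcons p1 z) p2; rewrite -topredE /= => ->; apply/orP; left.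
have := acyE cyc; rewrite /= size_cat size_rcons size_rev.
case: p1 eap {cyc} => [|? ?] /=; last by case: (q1).
move=> [az _]; case: q1 ebq {nq1} => [|? ?] //= [bz _].
by rewrite az bz eqxx in ab.
Qed.

Lemma simple_path_unique (x : V) p q :
  path E x p -> path E x q -> uniq (x :: p) -> uniq (x :: q) ->
  last x p = last x q -> p = q.
Proof.
elim: p x q => [|a p IH] x [|b q] //=.
- by move=> _ _ _ /andP[xq _] xl; rewrite {1}xl mem_last in xq.
- by move=> _ _ /andP[xq _] _ xl; rewrite -{1}xl mem_last in xq.
move=> Ep Eq Up Uq lpq.
have ab := simple_paths_eq_head Ep Eq Up Uq lpq.
move: Ep Eq Up Uq lpq; rewrite -ab => /andP[_ Ep] /andP[_ Eq] /andP[_ Up] /andP[_ Uq] lpq.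
by rewrite (IH a q).
Qed.

End SimplePaths.

(** * Depth, parents and balls around a root *)

Section Rooted.
Local Open Scope nat_scope.
Local Open Scope fset_scope.
Variables (V : choiceType) (E : rel V).
Hypotheses (symE : symmetric E) (acyE : forall c : seq V, ucycle E c -> size c <= 2).
Hypothesis conE : forall x y, exists2 p, path E x p & last x p = y.
Variable r : V.

Lemma depth_exists x : exists n, `[< exists p, [/\ path E r p, last r p = x & size p = n] >].
Proof. by have [p ? ?] := conE r x; exists (size p); apply/asboolP; exists p. Qed.

Definition depth x := ex_minn (depth_exists x).

Lemma depth_le p : path E r p -> depth (last r p) <= size p.
Proof.
move=> Ep; rewrite /depth; case: ex_minnP => n _; apply.
by apply/asboolP; exists p.
Qed.

Lemma depth_path x : exists p, [/\ path E r p, last r p = x & size p = depth x].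
Proof. by rewrite /depth; case: ex_minnP => n /asboolP. Qed.

Lemma geodesic_uniq p : path E r p -> size p = depth (last r p) -> uniq (r :: p).
Proof.
move=> Ep; case/shortenP: (Ep) => p' Ep' Up' sub sp.
apply: (leq_size_uniq Up'); last by rewrite /= ltnS sp depth_le.
by move=> y; rewrite !inE => /predU1P[->|/sub->]; rewrite ?eqxx ?orbT.
Qed.

Lemma simple_path_size p : path E r p -> uniq (r :: p) -> size p = depth (last r p).
Proof.
move=> Ep Up; have [p' [Ep' lp' sp']] := depth_path (last r p).
rewrite -sp'; congr size; apply: (simple_path_unique symE acyE Ep Ep' Up) => //.
by apply: geodesic_uniq; rewrite // lp'.
Qed.

Lemma depth_root : depth r = 0.
Proof. by apply/eqP; rewrite -leqn0 (depth_le (p := [::])). Qed.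

Lemma depth_eq0 x : depth x = 0 -> x = r.
Proof. by move=> x0; have [[|? ?] [_ px]] := depth_path x; rewrite x0. Qed.

(** Simple paths from the root are geodesics, so exhibiting one suffices: the geodesic to [x]
    extended by [y] or, if it already meets [y], its initial piece up to [y] extended by [x]. *)
Lemma depth_edge x y : irreflexive E -> E x y -> depth y = (depth x).+1 \/ depth x = (depth y).+1.
Proof.
move=> irrE Exy; have [p [Ep lp sp]] := depth_path x.
have Up : uniq (r :: p) by apply: geodesic_uniq; rewrite // lp.
have [yp|yp] := boolP (y \in r :: p); last first.
  left; have := @simple_path_size (rcons p y).
  rewrite rcons_path Ep lp Exy last_rcons size_rcons sp -rcons_cons rcons_uniq yp Up.
  by move=> ->.
right; case/splitPl: yp Ep lp sp Up => p1 p2 lp1.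
rewrite last_cat lp1 cat_path size_cat -cat_cons cat_uniq lp1.
move=> /andP[E1 E2] lp2 sp /and3P[U1 dis U2].
have p2N : p2 <> [::] by move=> p20; rewrite p20 /= in lp2; rewrite lp2 irrE in Exy.
have xp1 : x \notin r :: p1.
  have xp2 : x \in p2 by rewrite -lp2; case: (p2) p2N => // a l _; exact: (mem_last a l).
  exact: (hasPn dis x xp2).
rewrite -lp1 -(simple_path_size E1 U1).
have := @simple_path_size (rcons p1 x).
rewrite rcons_path E1 lp1 symE Exy last_rcons size_rcons -rcons_cons rcons_uniq xp1 U1.
by move=> ->.
Qed.

Lemma parent_exists x : x != r -> exists2 y, E x y & depth x = (depth y).+1.
Proof.
move=> xr; have [p [+ + +]] := depth_path x.
case/lastP: p => [_ /= xr'|p z]; first by rewrite xr' eqxx in xr.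
rewrite rcons_path last_rcons size_rcons => /andP[Ep Ez] zx sp; subst z.
exists (last r p); first by rewrite symE.
apply/eqP; rewrite eqn_leq; apply/andP; split; last by rewrite -sp ltnS depth_le.
have [p' [Ep' lp' <-]] := depth_path (last r p).
by have := @depth_le (rcons p' x); rewrite rcons_path Ep' lp' Ez last_rcons size_rcons => ->.
Qed.

Lemma parent_unique x y z :
  E x y -> E x z -> depth x = (depth y).+1 -> depth x = (depth z).+1 -> y = z.
Proof.
move=> Exy Exz xy xz.
have [p [Ep lp sp]] := depth_path y; have [q [Eq lq sq]] := depth_path z.
have Ep' : path E r (rcons p x) by rewrite rcons_path Ep lp symE.
have Eq' : path E r (rcons q x) by rewrite rcons_path Eq lq symE.
have /rcons_inj [pq] : rcons p x = rcons q x.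
  apply: (simple_path_unique symE acyE Ep' Eq'); rewrite ?last_rcons //;
  by apply: geodesic_uniq; rewrite // last_rcons size_rcons ?sp ?sq.
by rewrite -lp -lq pq.
Qed.

(** The default value makes the root its own parent. By irreflexivity, removing the parent from the
    neighbours of the root then removes nothing. *)
Definition parent x : V :=
  xget r [set y | E x y /\ depth x = (depth y).+1]%classic.

Lemma parent_eq x y : E x y -> depth x = (depth y).+1 -> parent x = y.
Proof.
move=> Exy xy; apply: xget_unique => [//|z [Exz xz]].
exact: parent_unique Exz Exy xz xy.
Qed.

Lemma parent_spec x : x != r -> E x (parent x) /\ depth x = (depth (parent x)).+1.
Proof. by move=> /parent_exists[y Exy xy]; rewrite (parent_eq Exy xy). Qed.

Lemma parent_root : parent r = r.
Proof. by apply: xgetPN => y [_]; rewrite depth_root. Qed.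

Lemma path_down x :
  exists p, [/\ path E r p, last r p = x & forall y, y \in p -> y = x \/ depth y < depth x].
Proof.
move: {2}(depth x) (leqnn (depth x)) => n; elim: n x => [|n IH] x xn.
  have -> : x = r by apply: depth_eq0; apply/eqP; rewrite -leqn0.
  by exists [::].
have [->|xr] := eqVneq x r; first by exists [::].
have [Ex dx] := parent_spec xr.
have [|p [Ep lp pp]] := IH (parent x); first by rewrite -ltnS -dx.
exists (rcons p x); split; first by rewrite rcons_path Ep lp symE.
  by rewrite last_rcons.
move=> y; rewrite mem_rcons inE => /predU1P[|/pp yp]; [by left|right].
by rewrite dx ltnS; case: yp => [->|/ltnW].
Qed.


Hypothesis irrE : irreflexive E.
Variable nbr : V -> {fset V}.
Hypothesis nbrE : forall x y, (y \in nbr x) = E x y.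

Fixpoint tree_ball n : {fset V} :=
  if n is m.+1 then tree_ball m `|` \bigcup_(x <- tree_ball m) nbr x else [fset r].

Lemma in_ball n x : (x \in tree_ball n) = (depth x <= n).
Proof.
elim: n x => [|n IH] x.
  by rewrite inE leqn0; apply/eqP/eqP => [->|/depth_eq0//]; exact: depth_root.
rewrite inE IH; apply/idP/idP => [/orP[/leqW//|/bigfcupP[y]]|xn].
  rewrite andbT IH nbrE => yn /(depth_edge irrE)[->//|yx].
  by rewrite leqW // ltnW // -yx.
have [xr|xr] := eqVneq x r; first by rewrite xr depth_root.
have [Ex dx] := parent_spec xr.
apply/orP; right; apply/bigfcupP; exists (parent x); last by rewrite nbrE symE.
by rewrite IH andbT -ltnS -dx.
Qed.

Definition tree_sphere n : {fset V} := [fset x in tree_ball n | depth x == n].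

Lemma in_sphere n x : (x \in tree_sphere n) = (depth x == n).
Proof. by rewrite !inE /= in_ball; case: ltngtP. Qed.

Definition kids x : {fset V} := nbr x `\ parent x.

Lemma in_kids x y : (y \in kids x) = (depth y == (depth x).+1) && (parent y == x).
Proof.
rewrite in_fsetD1 nbrE; apply/idP/idP => [/andP[yx Exy]|/andP[/eqP yx /eqP py]].
  case: (depth_edge irrE Exy) => d.
    by rewrite d eqxx; apply/eqP/parent_eq; rewrite // symE.
  by rewrite -(parent_eq Exy d) eqxx in yx.
have yr : y != r by apply/eqP => yr; rewrite yr depth_root in yx.
have [Ey dy] := parent_spec yr; rewrite py in Ey dy.
rewrite symE Ey andbT; apply/eqP => yE.
have [xr|/parent_spec[_ dx]] := eqVneq x r.
  by rewrite xr parent_root in yE; rewrite yE eqxx in yr.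
by move: dx (leqnSn (depth x).+1); rewrite -yE yx => <-; rewrite ltnn.
Qed.

Lemma card_kids x d : #|` nbr x| = d.+1 -> #|` kids x| = if x == r then d.+1 else d.
Proof.
move=> nx; have := cardfsD1 (parent x) (nbr x); rewrite -/(kids x) nx nbrE.
have [->|/parent_spec[-> _] [//]] := eqVneq x r; first by rewrite parent_root irrE => ->.
Qed.

(** The walk from [k] to the root and down to [parent j] meets depth [n.+1] at most in [k], so it
    avoids [j], and so does the self-avoiding path extracted from it. Thus, when a vertex of a
    sphere is integrated out, the rest of the ball, including the rest of the sphere, counts as
    past. *)
Lemma past_sphere n k j : depth j = n.+1 -> depth k <= n.+1 -> k != j ->
  past E (parent j) j k.
Proof.
move=> jn kn kj.
have jr : j != r by apply/eqP => jr; rewrite jr depth_root in jn.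
have [_ dj] := parent_spec jr; move: dj; rewrite jn => -[dj].
have avoid x p : depth x <= n.+1 -> x != j ->
    (forall y, y \in p -> y = x \/ depth y < depth x) -> j \notin r :: p.
  move=> xn xj xp; rewrite inE negb_or jr; apply/negP => /xp[jx|].
    by rewrite jx eqxx in xj.
  by rewrite jn ltnNge xn.
have [p [Ep lp pp]] := path_down k.
have [q [Eq lq pq]] := path_down (parent j).
have jp := avoid _ _ kn kj pp.
have jq : j \notin r :: q.
  apply: avoid pq; first by rewrite -dj.
  by apply/eqP => pj; move: jn; rewrite -pj -dj => /n_Sn.
have Es : path E k (rev (belast r p) ++ q).
  rewrite cat_path -{1}lp rev_path (eq_path (e' := E)) ?Ep //=.
  suff -> : last k (rev (belast r p)) = r by [].
  by case: (p) lp => //= a l _; rewrite rev_cons last_rcons.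
have ls : last k (rev (belast r p) ++ q) = parent j.
  rewrite last_cat -lq; congr last.
  by case: (p) lp => //= a l _; rewrite rev_cons last_rcons.
rewrite -ls; case/shortenP: Es => s Es Us sub; exists s; split=> //.
rewrite inE eq_sym negb_or kj; apply/negP => /sub.
rewrite mem_cat mem_rev => /orP[/mem_belast jb|jqq]; first by rewrite jb in jp.
by rewrite inE jqq orbT in jq.
Qed.

Lemma farther_kid x y : E x y -> farther E r x y -> y \in kids x.
Proof.
move=> Exy [p [Ep lp far]]; have [q [Eq lq sq]] := depth_path y.
have xy : depth x < depth y by rewrite -sq -lp (leq_ltn_trans (depth_le Ep)) // far.
rewrite in_kids; case: (depth_edge irrE Exy) => dxy; last by rewrite dxy ltnNge leqnSn in xy.
by rewrite dxy eqxx; apply/eqP/parent_eq; rewrite // symE.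
Qed.

(** * Regrouping products over balls by layers and by parents *)

Section Regroup.
Variables (T : Type) (idx : T) (op : Monoid.com_law idx).

Lemma big_ballS n (F : V -> T) :
  \big[op/idx]_(i <- tree_ball n.+1) F i =
  op (\big[op/idx]_(i <- tree_ball n) F i) (\big[op/idx]_(i <- tree_sphere n.+1) F i).
Proof.
rewrite -big_cat; apply: perm_big; apply: uniq_perm.
- exact: fset_uniq.
- rewrite cat_uniq !fset_uniq /= andbT; apply/hasPn => x /=.
  by rewrite in_sphere in_ball => /eqP->; rewrite ltnn.
- by move=> x; rewrite mem_cat in_sphere !in_ball leq_eqVlt ltnS orbC.
Qed.

Lemma big_sphere_kids n (F : V -> V -> T) :
  \big[op/idx]_(j <- tree_sphere n.+1) F j (parent j) =
  \big[op/idx]_(i <- tree_ball n) (if depth i == n then \big[op/idx]_(j <- kids i) F j i else idx).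
Proof.
transitivity (\big[op/idx]_(j <- tree_sphere n.+1)
    \big[op/idx]_(i <- tree_ball n | i == parent j) F j i).
  apply: eq_big_seq => j; rewrite in_sphere => /eqP dj.
  apply/esym/(@fbig_pred1_inj _ _ _ _ _ (fun i => F j i) id (tree_ball n)) => //.
  rewrite in_ball; have jr : j != r by apply/eqP => jr; rewrite jr depth_root in dj.
  by have [_] := parent_spec jr; rewrite dj => -[->].
under eq_bigr do rewrite big_mkcond.
rewrite exchange_big /=; apply: eq_big_seq => i; rewrite in_ball => di.
rewrite -big_mkcond; case: eqP => din; last first.
  rewrite big_seq_cond big1 // => j /andP[+ /eqP ij]; rewrite in_sphere => /eqP dj.
  have jr : j != r by apply/eqP => jr; rewrite jr depth_root in dj.
  by have [_] := parent_spec jr; rewrite dj -ij => -[/esym].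
rewrite -big_filter; apply: perm_big; apply: uniq_perm.
- by rewrite filter_uniq // fset_uniq.
- exact: fset_uniq.
- by move=> j; rewrite mem_filter in_kids in_sphere din andbC [i == _]eq_sym.
Qed.

End Regroup.

End Rooted.

(** * Integrals of products over sites *)

Section Cylinders.
Variable V : choiceType.
Implicit Types (A : set V) (i : V) (x : spin).

Lemma coord_sigma_field A i x : A i -> sigma_field A [set w : config V | w i = x].
Proof. by move=> Ai; apply: sub_sigma_algebra; exists i, x. Qed.

Lemma sigma_fieldI A (B C : set (config V)) :
  sigma_field A B -> sigma_field A C -> sigma_field A (B `&` C).
Proof. exact: (@measurableI _ (g_sigma_algebraType (coord_events A))). Qed.

Lemma sigma_fieldT A : sigma_field A setT.
Proof. exact: (@measurableT _ (g_sigma_algebraType (coord_events A))). Qed.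

Lemma measurable_sigma_field A (B : set (config V)) : sigma_field A B -> measurable B.
Proof. by apply: sub_sigma_algebra2 => C [i [x [_ ->]]]; exists i, x. Qed.

Lemma measurable_coord i x : measurable [set w : config V | w i = x].
Proof. exact: (@measurable_sigma_field [set i] _ (coord_sigma_field _ _)). Qed.

(** This makes a function measurable with respect to the spin at [i] constant on each event
    [w i = a]. *)
Lemma sigma_field1_invariant i (B : set (config V)) (w w' : config V) :
  sigma_field [set i] B -> w i = w' i -> B w -> B w'.
Proof.
move=> SB ww'; suff [] : B w <-> B w' by [].
move: B SB; apply: smallest_sub => [|C [k [x [-> ->]]]] /=; last by rewrite ww'.
split=> [//|B IB|B IB] /=.
  by split=> -[_ nB]; split=> // /IB.
by split=> -[n _ Bn]; exists n => //; apply/IB.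
Qed.

Lemma measurable_agree_on (L : {fset V}) (eta : config V) : measurable (agree_on L eta).
Proof.
have -> : agree_on L eta = \big[setI/setT]_(i <- L) [set w : config V | w i = eta i].
  apply/seteqP; split=> w /=; rewrite -bigcap_seq => h i /=; exact: h.
by apply: bigsetI_measurable => i _; exact: measurable_coord.
Qed.

End Cylinders.

Section SiteProducts.
Variables (R : realType) (V : choiceType).
Implicit Types (mu : probability (config V) R) (s : seq (V * (spin -> R))).

(** A list of pairs lets a site occur several times, as happens when several children send messages
    to one parent. *)
Definition site_prod s (w : config V) : R := \prod_(z <- s) z.2 (w z.1).

Lemma measurable_coord_fun i (h : spin -> R) :
  measurable_fun setT (fun w : config V => h (w i)).
Proof.
have -> : (fun w : config V => h (w i)) =
    (fun w => \sum_(c : spin) h c * \1_[set w : config V | w i = c] w).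
  apply/funext => w; rewrite (bigD1 (w i)) //= big1 => [|c ci].
    by rewrite indicE mem_set // mulr1 addr0.
  by rewrite indicE memNset ?mulr0 // => /esym/eqP; apply/negP.
apply: measurable_sum => c; apply: measurable_funM; first exact: measurable_cst.
exact: measurable_indic _ (measurable_coord i c).
Qed.

Lemma measurable_site_prod s : measurable_fun setT (site_prod s).
Proof.
elim: s => [|z s IH].
  by rewrite (_ : site_prod [::] = cst 1) //; apply/funext => w; rewrite /site_prod big_nil.
rewrite (_ : site_prod _ = fun w => z.2 (w z.1) * site_prod s w).
  exact: measurable_funM (measurable_coord_fun _ _) IH.
by apply/funext => w; rewrite /site_prod big_cons.
Qed.

Lemma site_prod_ge0 s w : (forall z, z \in s -> forall c, 0 <= z.2 c) -> 0 <= site_prod s w.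
Proof. by move=> s0; rewrite /site_prod big_seq prodr_ge0 // => z /s0. Qed.

Lemma integral_coord mu (A : set (config V)) i (h : spin -> R) (F : config V -> R) :
  measurable A -> measurable_fun setT F ->
  (forall c, 0 <= h c) -> (forall w, 0 <= F w) ->
  (\int[mu]_(w in A) (h (w i) * F w)%:E =
   \sum_(c : spin) (h c)%:E * \int[mu]_(w in A `&` [set w | w i = c]) (F w)%:E)%E.
Proof.
move=> mA mF h0 F0.
have AE : A = \big[setU/set0]_(c : spin) (A `&` [set w : config V | w i = c]).
  apply/seteqP; split=> w.
    by move=> Aw; rewrite -bigcup_seq; exists (w i) => //=; rewrite mem_index_enum.
  by rewrite -bigcup_seq => -[c _ []].
have mAc c : measurable (A `&` [set w : config V | w i = c]).
  by apply: measurableI => //; exact: measurable_coord.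
rewrite {1}AE ge0_integral_bigsetU //=.
- apply: eq_bigr => c _.
  rewrite -ge0_integralZl_EFin //.
  + by apply: eq_integral => w; rewrite inE => -[_ /= ->]; rewrite EFinM.
  + by move=> w _; rewrite lee_fin.
  + by apply/measurable_EFinP; apply: measurable_funS mF.
- exact: index_enum_uniq.
- apply/trivIsetP => c c' _ _ cc'; rewrite -subset0 => w [[_ /= wc] [_ /= wc']].
  by move: cc'; rewrite -wc -wc' eqxx.
- apply/measurable_EFinP; apply: measurable_funS (measurableT) _ _ => //.
  by apply: measurable_funM => //; exact: measurable_coord_fun.
- by move=> w _; rewrite lee_fin mulr_ge0.
Qed.

Lemma integral_coord1 mu (A : set (config V)) i (h : spin -> R) :
  measurable A -> (forall c, 0 <= h c) ->
  (\int[mu]_(w in A) (h (w i))%:E =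
   \sum_(c : spin) (h c)%:E * mu (A `&` [set w | w i = c]))%E.
Proof.
move=> mA h0; have := @integral_coord mu A i h (cst 1) mA.
under eq_integral do rewrite mulr1.
move=> -> //; apply: eq_bigr => c _; congr (_ * _)%E.
have mAc : measurable (A `&` [set w : config V | w i = c]).
  by apply: measurableI => //; exact: measurable_coord.
exact: etrans (integral_cst mu mAc 1%:E) (mul1e _).
Qed.

End SiteProducts.

(** * The Markov property along an edge *)

Section MarkovChain.
Variables (R : realType) (V : choiceType) (E : rel V) (P : spin -> spin -> R).
Variable mu : probability (config V) R.
Hypotheses (mcE : tree_markov_chain E mu) (tmP : transition_matrix E mu P).
Hypothesis mu_gt0 : forall i x, (0 < mu [set w : config V | w i = x])%E.
Hypothesis P_ge0 : forall x y, 0 <= P x y.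
Hypothesis irrE : irreflexive E.

Lemma past_self i j : E i j -> past E i j i.
Proof.
move=> Eij; exists [::]; split=> //=; rewrite inE.
by apply/eqP => ji; rewrite ji irrE in Eij.
Qed.

(** The common version [g] of the two conditional probabilities is constant on [w i = a].
    Integrating it there and dividing by the positive mass of that event identifies the constant as
    [P a b]; integrating it over the past event [B] intersected with [w i = a] gives the claim. *)
Lemma markov_step i j a b (B : set (config V)) : E i j -> sigma_field (past E i j) B ->
  mu (B `&` [set w | w i = a] `&` [set w | w j = b]) =
  ((P a b)%:E * mu (B `&` [set w | w i = a]))%E.
Proof.
move=> Eij SB; have [g [[_ _ gp] [gm _ gi]]] := mcE b Eij.
pose w0 : config V := fun=> a.
have ga w : w i = a -> g w = g w0.
  move=> wa; apply/esym.
  by apply: (sigma_field1_invariant (gm _ (measurable_set1 (g w)))) (_ : w i = w0 i) _.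
have ig (C : set (config V)) : measurable C ->
    (\int[mu]_(w in C `&` [set w | w i = a]) (g w)%:E =
     (g w0)%:E * mu (C `&` [set w | w i = a]))%E.
  move=> mC; rewrite -integral_cst; last by apply: measurableI => //; exact: measurable_coord.
  by apply: eq_integral => w; rewrite inE => -[_ /= /ga ->].
have Sa : sigma_field [set i] [set w : config V | w i = a] by exact: coord_sigma_field.
have gP : g w0 = P a b.
  have := ig setT measurableT; rewrite setTI gi // (tmP a b Eij) muleC.
  have /fineK <- : mu [set w : config V | w i = a] \is a fin_num.
    by rewrite fin_num_measure //; exact: measurable_coord.
  have : (0 < fine (mu [set w : config V | w i = a]))%R.
    by rewrite fine_gt0 // mu_gt0 ltey_eq fin_num_measure //; exact: measurable_coord.
  move=> m0; rewrite -!EFinM => -[]; move/mulIf => -> //.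
  by rewrite gt_eqF.
rewrite -gP -ig; last exact: measurable_sigma_field SB.
rewrite gp //; apply: sigma_fieldI => //; apply: coord_sigma_field.
exact: past_self.
Qed.

(** The induction fixes the spin at one site of [s] after another: its factor becomes a constant and
    [A] is intersected with another event of the past, which is why [A] is arbitrary. Once no factor
    is left, [markov_step] applies to each pair of values at [i] and [j]. *)
Lemma markov_leaf i j (g : spin -> R) s (A : set (config V)) : E i j ->
  sigma_field (past E i j) A ->
  (forall z, z \in s -> past E i j z.1 /\ forall c, 0 <= z.2 c) ->
  (forall c, 0 <= g c) ->
  (\int[mu]_(w in A) (site_prod s w * g (w j))%:E =
   \int[mu]_(w in A) (site_prod s w * \sum_(b : spin) P (w i) b * g b)%:E)%E.
Proof.
move=> Eij + + g0; have Pg0 c : 0 <= \sum_(b : spin) P c b * g b.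
  by apply: sumr_ge0 => b _; rewrite mulr_ge0.
elim: s A => [|z s IH] A SA sA.
  have mA := measurable_sigma_field SA.
  under eq_integral do rewrite /site_prod big_nil mul1r.
  under [RHS]eq_integral do rewrite /site_prod big_nil mul1r.
  rewrite integral_coord1 //.
  rewrite (@integral_coord1 _ _ mu A i (fun a => \sum_(b : spin) P a b * g b)) //.
  transitivity (\sum_(b : spin) \sum_(a : spin) (P a b * g b)%:E * mu (A `&` [set w | w i = a]))%E.
    apply: eq_bigr => b _.
    have mAb : measurable (A `&` [set w : config V | w j = b]).
      by apply: measurableI => //; exact: measurable_coord.
    have := @integral_coord1 _ _ mu _ i (fun=> 1) mAb (fun=> ler01).
    rewrite (etrans (integral_cst mu mAb 1%:E) (mul1e _)) => ->.
    rewrite ge0_sume_distrr; last by move=> a _; rewrite mul1e.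
    apply: eq_bigr => a _.
    rewrite mul1e setIAC markov_step // muleA; congr (_ * _)%E.
    by rewrite muleC.
  rewrite exchange_big /=; apply: eq_bigr => a _.
  rewrite -sumEFin ge0_sume_distrl // => b _; by rewrite lee_fin mulr_ge0.
have mA := measurable_sigma_field SA.
have sA' y : y \in s -> past E i j y.1 /\ forall c, 0 <= y.2 c.
  by move=> ys; apply: sA; rewrite inE ys orbT.
have [zp z0] := sA z (mem_head _ _).
have consE w (t : R) : site_prod (z :: s) w * t = z.2 (w z.1) * (site_prod s w * t).
  by rewrite /site_prod big_cons mulrA.
under eq_integral do rewrite consE.
under [RHS]eq_integral do rewrite consE.
have s0 w : 0 <= site_prod s w by apply: site_prod_ge0 => y /sA'[].
rewrite integral_coord //; last 2 first.
- by apply: measurable_funM; [exact: measurable_site_prod|exact: measurable_coord_fun].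
- by move=> w; rewrite mulr_ge0.
rewrite integral_coord //; last 2 first.
- apply: measurable_funM; first exact: measurable_site_prod.
  exact: (measurable_coord_fun i (fun a => \sum_(b : spin) P a b * g b)).
- by move=> w; rewrite mulr_ge0.
apply: eq_bigr => c _; rewrite IH //.
by apply: sigma_fieldI => //; exact: coord_sigma_field.
Qed.

End MarkovChain.

(** * Messages along an edge *)

Lemma big_spin (R : Type) (idx : R) (op : Monoid.com_law idx) (F : spin -> R) :
  \big[op/idx]_(x : spin) F x = op (F Plus) (op (F Minus) (F Zero)).
Proof.
rewrite (bigD1 Plus) //= (bigD1 Minus) //= (bigD1 Zero) //= big1 ?Monoid.mulm1 //.
by case.
Qed.

Lemma flipK : involutive flip. Proof. by case. Qed.

Lemma sum_spin (R : nmodType) (b : spin) (F : spin -> R) : b != Zero ->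
  \sum_(x : spin) F x = F b + F (flip b) + F Zero.
Proof. by rewrite big_spin; case: b => //= _; rewrite addrA // [F Plus + _]addrC. Qed.

Section Messages.
Variables (R : realType) (beta xi : R).
Hypotheses (beta0 : 0 < beta) (xi0 : 0 < xi).
Local Notation P := (transition_xi beta xi).
Local Notation q := (expR (- beta)).
Local Notation Q := (expR beta).

Definition message (f : spin -> R) (a : spin) : R := \sum_(c : spin) P a c * f c.

Let q0 : 0 < q := expR_gt0 _.
Let q1 : q < 1. Proof. by rewrite expR_lt1 oppr_lt0. Qed.
Let qQ : q * Q = 1. Proof. by rewrite -expRD addNr expR0. Qed.

Let den_gt0 : 0 < 1 + (1 + q) * xi.
Proof. by rewrite addr_gt0 // mulr_gt0 // addr_gt0. Qed.

Lemma transition_xi_gt0 x y : 0 < P x y.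
Proof.
rewrite /transition_xi; case: eqP => _; rewrite divr_gt0 //.
- by case: ifP.
- by rewrite addr_gt0 // mulr_gt0.
- by case: ifP => // _; case: ifP => // _; rewrite mulr_gt0.
Qed.

(** The sum of all ratios of entries bounds each of them. This crude constant later controls the
    weight of [Zero] at the root, uniformly in the radius of the ball. *)
Lemma transition_xi_comparable :
  exists2 C : R, 0 < C & forall a a' c, P a c <= C * P a' c.
Proof.
pose C := \sum_(z : spin * spin * spin) P z.1.1 z.2 / P z.1.2 z.2.
have C0 z : 0 <= P z.1.1 z.2 / P z.1.2 z.2.
  by rewrite divr_ge0 // ltW // transition_xi_gt0.
exists C => [|a a' c].
  rewrite /C (bigD1 (Zero, Zero, Zero)) //= ltr_wpDr //; first exact: sumr_ge0.
  by rewrite divr_gt0 // transition_xi_gt0.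
rewrite -ler_pdivrMr ?transition_xi_gt0 // /C (bigD1 (a, a', c)) //= lerDl.
exact: sumr_ge0.
Qed.

Lemma message_ge0 f a : (forall c, 0 <= f c) -> 0 <= message f a.
Proof. by move=> f0; apply: sumr_ge0 => c _; rewrite mulr_ge0 // ltW // transition_xi_gt0. Qed.

Lemma message_gt0 f a : (forall c, 0 <= f c) -> (exists c, 0 < f c) -> 0 < message f a.
Proof.
move=> f0 [c fc]; rewrite /message (bigD1 c) //= ltr_wpDr //.
  by apply: sumr_ge0 => c' _; rewrite mulr_ge0 // ltW // transition_xi_gt0.
by rewrite mulr_gt0 // transition_xi_gt0.
Qed.

Lemma message_comparable C f a a' : (forall a a' c, P a c <= C * P a' c) ->
  (forall c, 0 <= f c) -> message f a <= C * message f a'.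
Proof.
by move=> PC f0; rewrite /message mulr_sumr; apply: ler_sum => c _; rewrite mulrA ler_wpM2r.
Qed.

Lemma message_sign b f : b != Zero ->
  message f b = (f Zero + xi * f b + q * xi * f (flip b)) / (1 + (1 + q) * xi).
Proof.
move=> b0; rewrite /message (sum_spin _ b0) /transition_xi.
by case: b b0 => //= _; field; rewrite gt_eqF.
Qed.

Lemma flip_neq0 b : b != Zero -> flip b != Zero. Proof. by case: b. Qed.

(** This serves the children outside the tree, whose spin may be anything. The extreme case, [f]
    concentrated on [flip b], has ratio exactly [q]. *)
Lemma message_weak b f : b != Zero -> (forall c, 0 <= f c) ->
  q * message f (flip b) <= message f b.
Proof.
move=> b0 f0; rewrite !message_sign ?flip_neq0 // flipK mulrA ler_pM2r ?invr_gt0 //.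
have := f0 b; have := f0 (flip b); have := f0 Zero.
move: (f b) (f (flip b)) (f Zero) => x y z z0 y0 x0.
have qz : q * z <= z by rewrite ler_piMl // ltW.
have qx : q * (q * (xi * x)) <= xi * x.
  rewrite mulrA ler_piMl ?mulr_ge0 //; first exact: ltW.
  by rewrite -[1]mulr1 ler_pM // ltW.
lra.
Qed.

(** The ratio of the messages is [(u + q) / (1 + q u)] when the ratio of the
    weights is [u]. *)
Lemma message_dom u b f : b != Zero -> (forall c, 0 <= f c) -> f Zero = 0 -> 0 <= u ->
  u * f (flip b) <= f b ->
  (u + q) * message f (flip b) <= (1 + q * u) * message f b.
Proof.
move=> b0 f0 fz u0 fu; rewrite !message_sign ?flip_neq0 // flipK fz !mulrA ler_pM2r ?invr_gt0 //.
have := f0 b; have := f0 (flip b); move: (f b) (f (flip b)) fu => x y fu y0 x0.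
have : 0 <= xi * (1 - q ^+ 2) * (x - u * y).
  rewrite !mulr_ge0 ?subr_ge0 //; first exact: ltW.
  by rewrite expr_le1 // ltW.
nra.
Qed.

Definition mratio u := (u + q) / (1 + q * u).

Lemma message_mratio u b f : b != Zero -> (forall c, 0 <= f c) -> f Zero = 0 -> 0 <= u ->
  u * f (flip b) <= f b -> mratio u * message f (flip b) <= message f b.
Proof.
move=> b0 f0 fz u0 fu; have den0 : 0 < 1 + q * u by rewrite ltr_wpDr // mulr_ge0 // ltW.
by rewrite /mratio mulrAC ler_pdivrMr // [leRHS]mulrC message_dom.
Qed.

Lemma mratio_ge1 u : 1 <= u -> 1 <= mratio u.
Proof.
move=> u1; have u0 : 0 < u by rewrite (lt_le_trans _ u1).
rewrite /mratio ler_pdivlMr; last by rewrite ltr_wpDr // mulr_ge0 // ltW.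
have : 0 <= (1 - q) * (u - 1) by rewrite mulr_ge0 // subr_ge0 // ltW.
lra.
Qed.

Lemma mratioQ : Q / 2 <= mratio Q.
Proof. by rewrite /mratio qQ ler_pM2r ?invr_gt0 ?addr_gt0 // lerDl ltW. Qed.

Lemma mratio_sqr u : 8 <= Q -> 1 <= u -> u <= Q -> u <= mratio u ^+ 2.
Proof.
move=> Q8 u1 uQ; have u0 : 0 < u by rewrite (lt_le_trans _ u1).
have den0 : 0 < 1 + q * u by rewrite ltr_wpDr // mulr_ge0 // ltW.
rewrite /mratio expr_div_n ler_pdivlMr ?exprn_gt0 //.
have qu : q * u <= 1 by rewrite -qQ ler_pM2l.
have h1 : q ^+ 2 * u ^+ 2 <= q * u by rewrite -exprMn expr2 ler_piMr ?mulr_ge0 // ltW.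
have h2 : q ^+ 2 <= q * u by rewrite expr2 ler_pM2l // ltW // (lt_le_trans _ u1).
have h3 : q ^+ 2 * u <= q * u.
  by rewrite expr2 -mulrA ler_piMl //; [exact/ltW/mulr_gt0|exact: ltW].
have q8 : q * 8 <= 1 by rewrite (le_trans (ler_wpM2l (ltW q0) Q8)) ?qQ.
have h4 : q * u * 8 <= u by rewrite mulrAC ler_piMl ?(ltW u0).
rewrite -subr_ge0.
(* The difference vanishes at [u = 1]. By [h1], [h2] and [h3] the cofactor of [u - 1] is at least
   [u - 5 * q * u], which [h4] makes nonnegative. *)
have -> : (u + q) ^+ 2 - u * (1 + q * u) ^+ 2 =
   (u - 1) * ((1 - 2 * q - q ^+ 2) * u - q ^+ 2 * u ^+ 2 - q ^+ 2) by ring.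
rewrite mulr_ge0 ?subr_ge0 //; lra.
Qed.

End Messages.

(** * The field exerted by an evolved spin *)

Section FlipProb.
Variables (R : realType) (t : R).
Local Notation e := (expR (- (2 * t))).

Lemma flip_prob0l y : flip_prob t Zero y = (y == Zero)%:R.
Proof. by rewrite /flip_prob; case: y => /=; rewrite ?mul0r ?mulr0 ?addr0 ?add0r ?mulr1. Qed.

Lemma flip_prob0r x : flip_prob t x Zero = (x == Zero)%:R.
Proof. by rewrite /flip_prob; case: x => /=; rewrite ?mulr0 ?addr0 ?add0r. Qed.

Lemma flip_prob_same b : b != Zero -> flip_prob t b b = (1 + e) / 2.
Proof. by rewrite /flip_prob; case: b => //= _; rewrite mulr1 mulr0 !addr0 mulrC. Qed.

Lemma flip_prob_flip b : b != Zero -> flip_prob t (flip b) b = (1 - e) / 2.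
Proof. by rewrite /flip_prob; case: b => //= _; rewrite mulr0 addr0 add0r mulr1 mulrC. Qed.

Hypothesis t0 : 0 < t.

Lemma decay_lt1 : e < 1. Proof. by rewrite expR_lt1 oppr_lt0 mulr_gt0. Qed.

Lemma flip_prob_ge0 x y : 0 <= flip_prob t x y.
Proof.
have e1 := ltW decay_lt1; have e0 := expR_ge0 (- (2 * t)).
by rewrite /flip_prob !addr_ge0 // !mulr_ge0 ?invr_ge0 ?subr_ge0 ?addr_ge0.
Qed.

Lemma flip_prob_gt0 x : 0 < flip_prob t x x.
Proof.
have [->|x0] := eqVneq x Zero; first by rewrite flip_prob0l.
by rewrite flip_prob_same // divr_gt0 // addr_gt0 // expR_gt0.
Qed.

(** The condition [3 * e <= 1] says that the field strength [(1 + e) / (1 - e)] is at most 2. *)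
Lemma flip_prob_le2 b y : 3 * e <= 1 -> b != Zero -> y != Zero ->
  flip_prob t (flip b) y <= 2 * flip_prob t b y.
Proof.
move=> e3 b0 y0; have e0 := expR_ge0 (- (2 * t)).
have [->|yb] : y = b \/ y = flip b by case: y y0; case: b b0; auto.
  by rewrite flip_prob_same // flip_prob_flip //; lra.
have {b0}yb : b = flip y by rewrite yb flipK.
by rewrite yb flipK flip_prob_same // flip_prob_flip //; lra.
Qed.

End FlipProb.

(** * Estimates on powers *)

Section Powers.
Variable R : realType.

Lemma prod_two_values (V : choiceType) (C D : {fset V}) (x y : R) : (C `<=` D)%fset ->
  \prod_(j <- D) (if j \in C then x else y) = x ^+ #|` C| * y ^+ (#|` D| - #|` C|).
Proof.
move=> CD; rewrite (big_fsetID _ (mem C)) /=.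
have DC : [fset j in D | j \in C]%fset = C.
  apply/fsetP => j; rewrite !inE /= andbC; case: (boolP (j \in C)) => // jC.
  by rewrite (fsubsetP CD).
have DnC : [fset j in D | j \notin C]%fset = (D `\` C)%fset.
  by apply/fsetP => j; rewrite !inE /= andbC.
congr (_ * _).
  rewrite DC big_seq (eq_bigr (fun=> x)) => [|j ->//].
  by rewrite -big_seq big_const_seq iter_mulr_1 count_predT.
rewrite DnC big_seq (eq_bigr (fun=> y)) => [|j]; last by rewrite inE => /andP[/negbTE->].
by rewrite -big_seq big_const_seq iter_mulr_1 count_predT -cardfsDS.
Qed.

Lemma expr_unbounded (x M : R) : 1 < x -> exists n, M <= x ^+ n.
Proof.
move=> x1; have bern n : 1 + n%:R * (x - 1) <= x ^+ n.
  elim: n => [|n IH]; first by rewrite mul0r addr0 expr0.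
  rewrite exprS; apply: (@le_trans _ _ (x * (1 + n%:R * (x - 1)))).
    have : 0 <= n%:R * (x - 1) ^+ 2 by rewrite mulr_ge0 // sqr_ge0.
    rewrite -natr1; nra.
  by rewrite ler_pM2l // (lt_trans _ x1).
exists (Num.bound `|M / (x - 1)|); apply: le_trans (bern _).
have x10 : 0 < x - 1 by rewrite subr_gt0.
rewrite ler_wpDl // -ler_pdivrMr //; apply: le_trans (ler_norm _) _.
exact/ltW/archi_boundP/normr_ge0.
Qed.

(** Since [q * Q = 1], the right-hand side is [Q ^ (2s - d) / 2 ^ s]. The exponent is at least 2,
    and one of the two factors [Q] pays for [2 ^ (s + 1)]. *)
Lemma tree_gain (d s : nat) (Q q : R) : (d.+1 < 2 * s)%N -> (s <= d)%N ->
  0 < q -> q * Q = 1 -> 2 ^+ s.+1 <= Q -> 2 * Q <= (Q / 2) ^+ s * q ^+ (d - s).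
Proof.
move=> ds sd q0 qQ Q2.
have Q1 : 1 <= Q by rewrite (le_trans _ Q2) // exprn_ege1 // ler1n.
have Q0 : 0 < Q by rewrite (lt_le_trans _ Q1).
have sE : s = ((d - s) + (2 * s - d))%N by lia.
have -> : (Q / 2) ^+ s * q ^+ (d - s) = Q ^+ (2 * s - d) / 2 ^+ s.
  have qQe : q ^+ (d - s) * Q ^+ (d - s) = 1 by rewrite -exprMn qQ expr1n.
  rewrite expr_div_n [in Q ^+ s]sE exprD -[RHS]mul1r -[X in _ = X * _]qQe.
  by move: (Q ^+ (d - s)) (q ^+ (d - s)) (Q ^+ (2 * s - d)) ((2 ^+ s)^-1) => x y z w; ring.
rewrite ler_pdivlMr ?exprn_gt0 //.
apply: (@le_trans _ _ (Q ^+ 2)); last by rewrite ler_weXn2l //; lia.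
by rewrite mulrAC -exprS expr2 ler_wpM2r // ltW.
Qed.

End Powers.

(** * Integrating out the layers of a ball *)

Section Peeling.
Variables (V : choiceType) (E : rel V).
Hypotheses (symE : symmetric E) (irrE : irreflexive E).
Hypothesis acyE : forall c : seq V, ucycle E c -> (size c <= 2)%N.
Hypothesis conE : forall x y, exists2 p, path E x p & last x p = y.
Variables (r : V) (nbr : V -> {fset V}).
Hypothesis nbrE : forall x y, (y \in nbr x) = E x y.
Local Notation depth := (depth conE r).
Local Notation parent := (parent conE r).
Local Notation kids := (kids conE r nbr).
Local Notation tree_ball := (tree_ball r nbr).
Local Notation tree_sphere := (tree_sphere conE r nbr).
Let in_ball := in_ball symE acyE conE r irrE nbrE.
Let in_sphere := in_sphere symE acyE conE r irrE nbrE.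
Let in_kids := in_kids symE acyE conE r irrE nbrE.

Variables (R : realType) (beta xi : R).
Hypotheses (beta0 : 0 < beta) (xi0 : 0 < xi).
Local Notation P := (transition_xi beta xi).
Variable mu : probability (config V) R.
Hypotheses (mcE : tree_markov_chain E mu) (tmP : transition_matrix E mu P).
Hypothesis mu_gt0 : forall i x, (0 < mu [set w : config V | w i = x])%E.
Implicit Types (h : V -> spin -> R) (s : seq (V * (spin -> R))).

Let P_ge0 x y : 0 <= P x y. Proof. exact/ltW/transition_xi_gt0. Qed.

(** Leaves are removed one at a time. The leaves still present lie in the past of the edge being
    crossed, and each message produced joins [s] as a further factor at the parent. *)
Lemma integral_leaves n (l : seq V) h s : uniq l -> {subset l <= tree_sphere n.+1} ->
  (forall i c, 0 <= h i c) ->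
  (forall z, z \in s -> (depth z.1 <= n)%N /\ forall c, 0 <= z.2 c) ->
  (\int[mu]_w (site_prod s w * \prod_(j <- l) h j (w j))%:E =
   \int[mu]_w (site_prod s w * \prod_(j <- l) message beta xi (h j) (w (parent j)))%:E)%E.
Proof.
move=> + + h0; elim: l s => [|j l IH] s.
  by move=> *; apply: eq_integral => w _; rewrite !big_nil.
move=> /= /andP[jl ul] sub s0.
have /eqP dj : depth j == n.+1 by rewrite -in_sphere sub // mem_head.
have jr : j != r by apply/eqP => jr; rewrite jr depth_root in dj.
have [Ej dpj] := parent_spec symE acyE conE jr.
have {}dpj : depth (parent j) = n by move: dpj; rewrite dj => -[].
have subl : {subset l <= tree_sphere n.+1} by move=> k kl; rewrite sub // inE kl orbT.
pose s1 := s ++ [seq (k, h k) | k <- l].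
transitivity (\int[mu]_w (site_prod s1 w * h j (w j))%:E)%E.
  apply: eq_integral => w _; congr _%:E.
  by rewrite /site_prod big_cat big_map big_cons /= mulrA mulrAC.
have s1P z : z \in s1 -> past E (parent j) j z.1 /\ forall c, 0 <= z.2 c.
  rewrite mem_cat => /orP[/s0[zn z0]|/mapP[k kl ->]]; split=> //=.
    apply: (past_sphere symE acyE dj); first exact: leqW.
    by apply/eqP => zj; move: zn; rewrite zj dj ltnn.
  apply: (past_sphere symE acyE dj).
    by have := subl _ kl; rewrite in_sphere => /eqP->.
  by apply/eqP => kj; rewrite -kj kl in jl.
have Ej' : E (parent j) j by rewrite symE.
rewrite (markov_leaf mcE tmP mu_gt0 P_ge0 irrE Ej' (@sigma_fieldT _ _) s1P (h0 j)).
transitivity (\int[mu]_w (site_prod ((parent j, message beta xi (h j)) :: s) w *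
                          \prod_(j <- l) h j (w j))%:E)%E.
  apply: eq_integral => w _; congr _%:E.
  by rewrite /site_prod big_cat big_map big_cons /= -/(message _ _ _ _) mulrC mulrA.
rewrite IH //.
  apply: eq_integral => w _; congr _%:E.
  by rewrite /site_prod !big_cons /= mulrCA mulrA.
move=> z; rewrite inE => /predU1P[->|/s0//] /=; rewrite dpj; split=> // c.
exact: message_ge0.
Qed.

(** Only depth [n] absorbs messages. Entries at larger depth stay in [h], but the product over the
    ball of radius [n] no longer sees them. *)
Definition peel_step n h : V -> spin -> R := fun i a =>
  h i a * if depth i == n then \prod_(j <- kids i) message beta xi (h j) a else 1.

Fixpoint peel n h : V -> spin -> R := if n is m.+1 then peel m (peel_step m h) else h.

Lemma peel_ind (Pr : nat -> (V -> spin -> R) -> Prop) N h :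
  (forall n h, (n < N)%N -> Pr n.+1 h -> Pr n (peel_step n h)) -> Pr N h -> Pr 0%N (peel N h).
Proof.
elim: N h => [//|N IH] h st PN /=; apply: IH; last exact: st.
by move=> n h' nN; apply: st; rewrite ltnW.
Qed.

Lemma peel_step_ge0 n h : (forall i c, 0 <= h i c) -> forall i c, 0 <= peel_step n h i c.
Proof.
move=> h0 i c; rewrite /peel_step; case: ifP; rewrite ?mulr1 // => _.
by rewrite mulr_ge0 // prodr_ge0 // => j _; exact: message_ge0.
Qed.

Lemma integral_ballS n h s : (forall i c, 0 <= h i c) ->
  (forall z, z \in s -> (depth z.1 <= n)%N /\ forall c, 0 <= z.2 c) ->
  (\int[mu]_w (site_prod s w * \prod_(i <- tree_ball n.+1) h i (w i))%:E =
   \int[mu]_w (site_prod s w * \prod_(i <- tree_ball n) peel_step n h i (w i))%:E)%E.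
Proof.
move=> h0 s0; pose s1 := s ++ [seq (i, h i) | i <- tree_ball n].
transitivity (\int[mu]_w (site_prod s1 w * \prod_(j <- tree_sphere n.+1) h j (w j))%:E)%E.
  apply: eq_integral => w _; congr _%:E.
  by rewrite /site_prod big_cat big_map (big_ballS symE acyE conE r irrE nbrE) /= mulrA.
rewrite (@integral_leaves n) ?fset_uniq //.
  apply: eq_integral => w _; congr _%:E.
  rewrite (big_sphere_kids symE acyE conE r irrE nbrE _ n (fun j i => message beta xi (h j) (w i))).
  by rewrite /site_prod big_cat big_map /= -mulrA -big_split.
move=> z; rewrite mem_cat => /orP[/s0//|/mapP[k kl ->]]; split=> //=.
by rewrite -in_ball.
Qed.

(** Keeping the observable [k] apart from [h] makes the peeled root weights the same for every
    [k]. *)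
Lemma integral_ball n h (k : spin -> R) : (forall i c, 0 <= h i c) -> (forall c, 0 <= k c) ->
  (\int[mu]_w (k (w r) * \prod_(i <- tree_ball n) h i (w i))%:E =
   \sum_(x : spin) (k x * peel n h r x)%:E * mu [set w | w r = x])%E.
Proof.
move=> + k0; elim: n h => [|n IH] h h0.
  under eq_integral do rewrite big_seq_fset1.
  rewrite (@integral_coord1 _ _ mu setT r (fun x => k x * h r x)) //.
    by apply: eq_bigr => x _; rewrite setTI.
  by move=> c; rewrite mulr_ge0.
rewrite -[peel n.+1 h]/(peel n (peel_step n h)) -IH; last exact: peel_step_ge0.
have rE h' m : (\int[mu]_w (site_prod [:: (r, k)] w * \prod_(i <- tree_ball m) h' i (w i))%:E =
    \int[mu]_w (k (w r) * \prod_(i <- tree_ball m) h' i (w i))%:E)%E.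
  by apply: eq_integral => w _; rewrite /site_prod big_seq1.
rewrite -!rE integral_ballS // => z; rewrite inE => /eqP -> /=.
by rewrite depth_root.
Qed.


(** * Domination of the boundary sign [b] over its opposite *)

Variable b : spin.
Hypothesis b_neq0 : b != Zero.
Local Notation Q := (expR beta).
Local Notation q := (expR (- beta)).
Local Notation msg := (message beta xi).

Definition dominates (u : R) (f : spin -> R) := f Zero = 0 /\ u * f (flip b) <= f b.

Lemma dominates_le u u' f : 0 <= f (flip b) -> u' <= u -> dominates u f -> dominates u' f.
Proof. by move=> f0 uu' [fz fu]; split=> //; rewrite (le_trans _ fu) // ler_wpM2r. Qed.

Lemma prod_dominated (D : {fset V}) (kappa : V -> R) (f g : V -> R) :
  (forall j, j \in D -> 0 <= kappa j) -> (forall j, j \in D -> 0 <= f j) ->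
  (forall j, j \in D -> kappa j * f j <= g j) ->
  (\prod_(j <- D) kappa j) * \prod_(j <- D) f j <= \prod_(j <- D) g j.
Proof.
move=> k0 f0 kfg; rewrite -big_split /= big_seq [leRHS]big_seq.
by apply: ler_prod => j jD; rewrite mulr_ge0 ?k0 ?f0 // kfg.
Qed.

(** Two children already restore the ratio [u], by [mratio_sqr]; further ones do no harm since
    [mratio] is at least 1. *)
Lemma prod_message_uniform u h (D : {fset V}) : (forall i c, 0 <= h i c) -> 8 <= Q ->
  1 <= u -> u <= Q -> (1 < #|` D|)%N -> (forall j, j \in D -> dominates u (h j)) ->
  u * \prod_(j <- D) msg (h j) (flip b) <= \prod_(j <- D) msg (h j) b.
Proof.
move=> h0 Q8 u1 uQ D2 dom.
have r1 := mratio_ge1 beta0 u1.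
have u0 : 0 <= u by rewrite (le_trans _ u1).
apply: (@le_trans _ _ ((\prod_(j <- D) mratio beta u) * \prod_(j <- D) msg (h j) (flip b))).
  rewrite ler_wpM2r ?prodr_ge0 // => [j _|]; first exact: message_ge0.
  rewrite (le_trans (mratio_sqr beta0 Q8 u1 uQ)) //.
  by rewrite big_const_seq iter_mulr_1 count_predT ler_weXn2l.
apply: prod_dominated => j jD; first by rewrite (le_trans _ r1).
  exact: message_ge0.
by have [hz hu] := dom j jD; exact: message_mratio.
Qed.

Lemma prod_message_subset h (C D : {fset V}) : (forall i c, 0 <= h i c) -> (C `<=` D)%fset ->
  (forall j, j \in C -> dominates Q (h j)) ->
  (Q / 2) ^+ #|` C| * q ^+ (#|` D| - #|` C|) * \prod_(j <- D) msg (h j) (flip b) <=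
  \prod_(j <- D) msg (h j) b.
Proof.
move=> h0 CD dom; rewrite -prod_two_values //; apply: prod_dominated => j jD.
- by case: ifP => _; rewrite ?divr_ge0 // expR_ge0.
- exact: message_ge0.
case: ifPn => jC; last exact: message_weak.
have [hz hu] := dom j jC.
apply: le_trans (message_mratio beta0 xi0 b_neq0 (h0 j) hz (expR_ge0 _) hu).
by rewrite ler_wpM2r ?mratioQ // message_ge0.
Qed.

(** * Induction over layers, with [Lambda] the ball of radius [n0] and the annulus reaching to
    radius [N] *)

Variables (d s : nat) (T : set V) (n0 N : nat) (t : R) (zeta : config V) (Cst : R).
Hypotheses (hds : (d.+1 < 2 * s)%N) (sd : (s <= d)%N).
Hypothesis card_nbr : forall x, #|` nbr x| = d.+1.
Hypotheses (Tr : T r) (T_kids : forall x, T x ->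
  exists2 C : {fset V}, #|` C| = s & (C `<=` kids x)%fset /\ forall y, y \in C -> T y).
Hypotheses (t0 : 0 < t) (e3 : 3 * expR (- (2 * t)) <= 1).
Hypotheses (Q_large : 2 ^+ s.+1 <= Q) (n0N : (n0 < N)%N).
Local Notation rho := ((1 + expR (- (2 * t))) / (1 - expR (- (2 * t)))).
Hypothesis rho_large : Q <= rho ^+ (N - n0.+1).
Hypothesis zeta_T : forall i, T i -> (depth i <= n0)%N -> zeta i != Zero.
Hypothesis zeta_out : forall i, (n0 < depth i)%N -> zeta i = b.
Hypothesis (PC : forall a a' c, P a c <= Cst * P a' c).

(** The root is [Lambda_0]: the evolved spin there is not conditioned on. *)
Definition site_factor (i : V) (a : spin) : R :=
  if i == r then 1 else flip_prob t a (zeta i).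

(** Each layer of the annulus gains a factor [rho] until the ratio reaches [Q]. *)
Definition threshold k := Num.min Q (rho ^+ k).

(** State after all layers beyond [n] have been integrated out. In the annulus every vertex of depth
    [n] favours [b], inside [Lambda] only those of [T] are known to. The root is listed apart: it
    carries no field, and its weight for [Zero] need not vanish, so comparability has to bound
    it. *)
Definition peel_invariant n h :=
  [/\ forall i c, 0 <= h i c, forall i, exists c, 0 < h i c,
      forall i, (depth i < n)%N -> h i = site_factor i,
      forall i, depth i = n -> (0 < n)%N ->
        if (n0 < n)%N then dominates (threshold (N - n)) (h i) else T i -> dominates Q (h i)
    & n = 0%N -> [/\ 2 * h r (flip b) <= h r b, forall a, 0 < h r a
        & forall a a', h r a <= Cst ^+ d.+1 * h r a']].

Let d2 : (1 < d)%N. Proof. by clear -hds sd; lia. Qed.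
Let s2 : (2 < s.+1)%N. Proof. by clear -hds sd; lia. Qed.

Let Q8 : 8 <= Q.
Proof.
rewrite (le_trans _ Q_large) // (_ : 8 = 2 ^+ 3); last by rewrite -natrX.
by rewrite ler_weXn2l ?ler1n.
Qed.

Let e1 := decay_lt1 t0.
Let e0 := expR_gt0 (- (2 * t)).

Let rho1 : 1 < rho.
Proof. by rewrite ltr_pdivlMr ?subr_gt0 // mul1r ltrD2l gtrN. Qed.

Let threshold_ge1 k : 1 <= threshold k.
Proof. by rewrite /threshold le_min exprn_ege1 ?(ltW rho1) // (le_trans _ Q8) // ler1n. Qed.

Let thresholdQ k : threshold k <= Q. Proof. by rewrite /threshold ge_min lexx. Qed.

Let thresholdS k : threshold k.+1 <= rho * threshold k.
Proof.
have rho0 : 0 < rho by rewrite (lt_trans _ rho1).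
rewrite /threshold exprS minr_pMr ?(ltW rho0) // le_min !ge_min lexx orbT andbT.
by rewrite ler_peMl ?expR_ge0 // ltW.
Qed.

Let root_depth i : (depth i == 0)%N = (i == r).
Proof. by apply/eqP/eqP => [/depth_eq0//|->]; exact: depth_root. Qed.

(** At the interface [n = n0] the children belong to the innermost annulus layer, where [rho_large]
    has raised the threshold to [Q]; further inside, the invariant says it directly. *)
Lemma T_kids_dominate n h i j : peel_invariant n.+1 h -> (n <= n0)%N ->
  depth i = n -> T j -> j \in kids i -> dominates Q (h j).
Proof.
move=> [hge _ _ hd _] nn0 din Tj; rewrite in_kids din => /andP[/eqP dj _].
have := hd j dj isT; rewrite ltnS.
case: ifP => [n0n|_]; last exact.
have -> : n = n0 by apply/eqP; rewrite eqn_leq nn0.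
by apply: dominates_le; rewrite // /threshold le_min lexx.
Qed.

Lemma peel_invariant_step n h : (n < N)%N -> peel_invariant n.+1 h ->
  peel_invariant n (peel_step n h).
Proof.
move=> nN hI; have [hge hgt hf hd _] := hI.
have mgt j a : 0 < msg (h j) a by exact: message_gt0.
have pgt i a : 0 < \prod_(j <- kids i) msg (h j) a by apply: prodr_gt0.
have stepE i : depth i = n -> forall a,
    peel_step n h i a = site_factor i a * \prod_(j <- kids i) msg (h j) a.
  by move=> di a; rewrite /peel_step di eqxx hf // di.
have treeM i : (n <= n0)%N -> depth i = n -> T i ->
    (Q / 2) ^+ s * q ^+ (#|` kids i| - s) * \prod_(j <- kids i) msg (h j) (flip b) <=
    \prod_(j <- kids i) msg (h j) b.
  move=> nn0 din Ti; have [C cC [Ck CT]] := T_kids Ti.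
  rewrite -cC; apply: prod_message_subset => // j jC.
  by apply: (T_kids_dominate hI nn0 din (CT _ jC)); exact: (fsubsetP Ck).
have qQ : q * Q = 1 by rewrite -expRD addNr expR0.
have gain := tree_gain hds sd (expR_gt0 (- beta)) qQ Q_large.
split.
- exact: peel_step_ge0.
- move=> i; have [c hc] := hgt i; exists c; rewrite /peel_step.
  by case: ifP => _; rewrite ?mulr1 // mulr_gt0.
- move=> i di; rewrite -hf; last exact: ltnW.
  by apply/funext => a; rewrite /peel_step ltn_eqF // mulr1.
- move=> i di n_gt0.
  have ir : i != r by rewrite -root_depth di -lt0n.
  have sf a : site_factor i a = flip_prob t a (zeta i) by rewrite /site_factor (negbTE ir).
  have ck : #|` kids i| = d.
    by rewrite (card_kids symE acyE conE r irrE nbrE (card_nbr i)) (negbTE ir).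
  case: ifPn => [n0n|]; last first.
    (* Inside [Lambda]: the children provide [2 * Q] by [tree_gain], and the field of [zeta i] costs
       at most the factor 2. *)
    rewrite -leqNgt => nn0 Ti; rewrite /dominates !stepE // !sf.
    have zi : zeta i != Zero by rewrite zeta_T // di.
    split; first by rewrite flip_prob0l (negbTE zi) mul0r.
    have := treeM i nn0 di Ti; rewrite ck => tM.
    have := flip_prob_le2 e3 b_neq0 zi.
    have p0 := flip_prob_ge0 t0 b (zeta i).
    move: (flip_prob _ (flip b) _) (flip_prob _ b _) p0 => x y y0 xy.
    have := ltW (pgt i (flip b)); move: (\prod_(j <- _) _ (flip b)) tM => M tM M0.
    apply: (@le_trans _ _ (2 * y * (Q * M))).
      by rewrite mulrCA ler_wpM2r // mulr_ge0 // expR_ge0.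
    rewrite [2 * y]mulrC -mulrA ler_wpM2l // mulrA; apply: le_trans tM.
    by rewrite ler_wpM2r.
  (* In the annulus: the children reproduce the threshold, and the field, which favours [b],
     multiplies it by [rho]. *)
  have zi : zeta i = b by rewrite zeta_out // di.
  rewrite /dominates !stepE // !sf zi.
  split; first by rewrite flip_prob0l (negbTE b_neq0) mul0r.
  rewrite flip_prob_flip // flip_prob_same //.
  have kd j : j \in kids i -> dominates (threshold (N - n.+1)) (h j).
    rewrite in_kids di => /andP[/eqP dj _].
    by have := hd j dj isT; rewrite ltnS ltnW.
  have := @prod_message_uniform _ _ (kids i) hge Q8 (threshold_ge1 _) (thresholdQ _) _ kd.
  rewrite ck.
  move=> /(_ d2).
  rewrite -(subnSK nN).
  have := thresholdS (N - n.+1).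
  have := ltW (pgt i (flip b)).
  move: (threshold (N - n.+1).+1) (threshold (N - n.+1)) (\prod_(j <- _) _ (flip b))
    (\prod_(j <- _) _ b).
  move=> v' v M M' M0 vv vM.
  have rE : rho * (1 - expR (- (2 * t))) = 1 + expR (- (2 * t)).
    by rewrite divfK // gt_eqF // subr_gt0.
  have e1' : 0 <= (1 - expR (- (2 * t))) / 2 by rewrite divr_ge0 // subr_ge0 ltW.
  apply: (@le_trans _ _ (rho * v * ((1 - expR (- (2 * t))) / 2 * M))).
    by rewrite ler_wpM2r //; apply: mulr_ge0.
  rewrite -[X in _ <= X / 2 * _]rE; move: rho (lt_trans ltr01 rho1) => p p0.
  move: (1 - expR _) e1' => x x0.
  have -> : p * v * (x / 2 * M) = p * x / 2 * (v * M) by ring.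
  by rewrite ler_wpM2l // -mulrA mulr_ge0 // ltW.
move=> n0'; have dr : depth r = n by rewrite depth_root.
have sr a : site_factor r a = 1 by rewrite /site_factor eqxx.
have ck : #|` kids r| = d.+1.
  by rewrite (card_kids symE acyE conE r irrE nbrE (card_nbr r)) eqxx.
split.
(* The root has [d.+1] children, one possible loss [q] more than elsewhere. This reduces the gain
   [2 * Q] to 2, and no field acts. *)
- have k2 : 2 <= (Q / 2) ^+ s * q ^+ (d.+1 - s).
    rewrite subSn // exprSr mulrA; apply: (@le_trans _ _ (2 * Q * q)).
      by rewrite -mulrA -expRD subrr expR0 mulr1.
    by rewrite ler_wpM2r // expR_ge0.
  rewrite !stepE // !sr !mul1r; have := treeM r.
  rewrite n0' depth_root ck => /(_ isT erefl Tr); apply: le_trans.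
  by apply: ler_wpM2r k2; exact: ltW.
- by move=> a; rewrite stepE // sr mul1r.
- move=> a a'; rewrite !stepE // !sr !mul1r.
  have <- : \prod_(j <- kids r) Cst = Cst ^+ d.+1.
    by rewrite big_const_seq iter_mulr_1 count_predT -ck.
  rewrite -big_split /=; apply: ler_prod => j _.
  by rewrite message_ge0 //= message_comparable.
Qed.

Lemma peel_root : [/\ 2 * peel N site_factor r (flip b) <= peel N site_factor r b,
  forall a, 0 < peel N site_factor r a
  & forall a a', peel N site_factor r a <= Cst ^+ d.+1 * peel N site_factor r a'].
Proof.
have : peel_invariant 0 (peel N site_factor).
  apply: (@peel_ind peel_invariant); first exact: peel_invariant_step.
  split=> //.
  - move=> i c; rewrite /site_factor; case: ifP => // _; exact: flip_prob_ge0.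
  - move=> i; exists (zeta i); rewrite /site_factor; case: ifP => // _; exact: flip_prob_gt0.
  (* The outermost sphere feels only its own field: the ratio is [rho], above the initial threshold
     1. *)
  - move=> i di N0; rewrite n0N.
    have ir : i != r by rewrite -root_depth di -lt0n.
    have zi : zeta i = b by rewrite zeta_out // di.
    rewrite /dominates /site_factor (negbTE ir) zi flip_prob0l (negbTE b_neq0).
    split=> //; rewrite flip_prob_flip // flip_prob_same // subnn /threshold expr0.
    rewrite min_r; last by rewrite (le_trans _ Q8) // ler1n.
    by rewrite mul1r ler_pM2r ?invr_gt0 //; have := e0; lra.
  - by move=> N0; move: n0N; rewrite N0.
by case=> _ _ _ _; apply.
Qed.


(** The kernel turns the time-[t] event into a product over time-0 sites. The factor of the root is
    taken as the observable, so the root weights [peel n site_factor r x] do not depend on [a]. *)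
Lemma evolved_agree_on (mu_t : probability (config V) R) (alpha : spin -> R) n a :
  (forall x, mu [set w | w r = x] = (alpha x)%:E) -> time_evolved t mu mu_t ->
  mu_t (agree_on (tree_ball n) (fun i => if i == r then a else zeta i)) =
  (\sum_(x : spin) flip_prob t x a * (peel n site_factor r x * alpha x))%:E.
Proof.
move=> mu_alpha [K KP ->]; last exact: measurable_agree_on.
have rD : r \in tree_ball n by rewrite in_ball depth_root.
transitivity (\int[mu]_w (flip_prob t (w r) a *
    \prod_(i <- tree_ball n) site_factor i (w i))%:E)%E.
  apply: eq_integral => w _; rewrite KP; congr _%:E.
  rewrite (big_fsetD1 r) //= eqxx; congr (_ * _); rewrite [RHS](big_fsetD1 r) //=.
  rewrite {1}/site_factor eqxx mul1r; apply: eq_big_seq => i.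
  by rewrite in_fsetD1 /site_factor => /andP[/negbTE-> _].
rewrite (@integral_ball n site_factor (fun x => flip_prob t x a)).
- by rewrite -sumEFin; apply: eq_bigr => x _; rewrite mu_alpha -EFinM mulrA.
- by move=> i c; rewrite /site_factor; case: ifP => // _; exact: flip_prob_ge0.
- by move=> c; exact: flip_prob_ge0.
Qed.

End Peeling.

(** * Conditional expectations of the evolved measure *)

Lemma elementary_cond_exp_coord (R : realType) (V : choiceType)
    (nu : probability (config V) R) (B : set (config V)) i (g W : spin -> R) :
  measurable B -> (forall a, 0 <= g a) ->
  (forall a, nu (B `&` [set w | w i = a]) = (W a)%:E) ->
  elementary_cond_exp nu (fun w => g (w i)) B =
  (\sum_(a : spin) g a * W a) / \sum_(a : spin) W a.
Proof.
move=> mB g0 nuW; rewrite /elementary_cond_exp; congr (_ / _).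
  rewrite (@integral_coord1 _ _ nu B i g) //.
  by under eq_bigr do rewrite nuW -EFinM; rewrite sumEFin.
have := @integral_coord1 _ _ nu B i (fun=> 1) mB (fun=> ler01).
rewrite (etrans (integral_cst nu mB 1%:E) (mul1e _)) => ->.
by under eq_bigr do rewrite nuW mul1e; rewrite sumEFin.
Qed.

Lemma sigma_field_coord_fun (R : realType) (V : choiceType) (r : V) (g : spin -> R) (Y : set R) :
  sigma_field [set` [fset r]%fset] ((fun w : config V => g (w r)) @^-1` Y).
Proof.
have -> : (fun w : config V => g (w r)) @^-1` Y =
    \big[setU/set0]_(x : spin | `[< Y (g x) >]) [set w : config V | w r = x].
  apply/seteqP; split=> w; rewrite -bigcup_seq_cond.
    move=> /= Yw; exists (w r) => //=; rewrite mem_index_enum; exact/asboolP.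
  by move=> [x /= /andP[_ /asboolP Yx] ->].
apply: (@bigsetU_measurable _ (g_sigma_algebraType (coord_events [set` [fset r]%fset]))) => x _.
by apply: coord_sigma_field; rewrite /= inE.
Qed.

(** The spin plus 1: being nonnegative, it is integrated without integrability
    conditions, and the shift cancels in differences of conditional expectations. *)
Definition spin_shift (R : realType) (x : spin) : R :=
  match x with Minus => 0 | Zero => 1 | Plus => 2 end.

(** The site dynamics preserves total mass, fixes [Zero] and contracts the expected spin by
    [expR (- (2 * t))]; the summand 1 is the shift. *)
Lemma evolved_magnetization (R : realType) (t : R) (A W : spin -> R) :
  0 < \sum_(x : spin) A x ->
  (forall a, W a = \sum_(x : spin) flip_prob t x a * A x) ->
  (\sum_(a : spin) spin_shift R a * W a) / (\sum_(a : spin) W a) =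
  1 + expR (- (2 * t)) * ((A Plus - A Minus) / \sum_(x : spin) A x).
Proof.
move=> A0 WE.
have Wb b : b != Zero ->
    W b = ((1 + expR (- (2 * t))) * A b + (1 - expR (- (2 * t))) * A (flip b)) / 2.
  move=> b0; rewrite WE (sum_spin _ b0) flip_prob_same // flip_prob_flip // flip_prob0l.
  by rewrite (negbTE b0) mul0r addr0; field.
have W0 : W Zero = A Zero.
  rewrite WE (bigD1 Zero) //= flip_prob0r eqxx mul1r big1 ?addr0 // => x.
  by rewrite flip_prob0r => /negbTE->; rewrite mul0r.
have sW : \sum_(a : spin) W a = \sum_(x : spin) A x.
  by rewrite !big_spin /= W0 !Wb //=; lra.
have Ane : \sum_(x : spin) A x != 0 by rewrite gt_eqF.
rewrite sW; apply: (mulIf Ane); rewrite divfK //.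
rewrite mulrDl mul1r -!mulrA mulVf // mulr1 !big_spin /= W0 !Wb //=; try by field.

Qed.

(** * The single-site law *)

Section InvariantLaw.
Variables (R : realType) (V : choiceType) (beta xi : R).
Variable mu : probability (config V) R.
Variable alpha : spin -> R.
Hypotheses (beta0 : 0 < beta) (xi0 : 0 < xi).
Hypothesis mu_alpha : forall i x, mu [set w | w i = x] = (alpha x)%:E.
Hypothesis alpha_inv : forall y, \sum_(x : spin) alpha x * transition_xi beta xi x y = alpha y.
Variable r : V.

Lemma alpha_sum1 : \sum_(x : spin) alpha x = 1.
Proof.
have mI := @integral_coord1 _ _ mu setT r (fun=> 1) measurableT (fun=> ler01).
have m1 := etrans (integral_cst mu measurableT 1%:E) (etrans (mul1e _) (probability_setT mu)).
have := etrans (esym mI) m1.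
under eq_bigr do rewrite setTI mul1e mu_alpha.
by rewrite sumEFin => -[].
Qed.

Lemma alpha_ge0 x : 0 <= alpha x.
Proof. by rewrite -lee_fin -(@mu_alpha r) measure_ge0. Qed.

(** All entries of the transition matrix are positive, so by invariance one vanishing mass would
    force all of them to vanish, against total mass 1. *)
Lemma alpha_gt0 y : 0 < alpha y.
Proof.
rewrite lt_neqAle alpha_ge0 andbT eq_sym; apply/eqP => ay.
have := alpha_inv y; rewrite ay => /eqP.
rewrite psumr_eq0 => [|x _]; last by rewrite mulr_ge0 ?alpha_ge0 // ltW // transition_xi_gt0.
move=> /allP al; have := alpha_sum1; rewrite big1 => [/eqP|x _].
  by rewrite eq_sym oner_eq0.
have := al x (mem_index_enum x); rewrite mulf_eq0 => /orP[/eqP//|].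
by rewrite gt_eqF // transition_xi_gt0.
Qed.

Lemma alpha_flip : flip_invariant mu -> alpha Plus = alpha Minus.
Proof.
move=> /(_ _ (measurable_coord r Plus)).
rewrite mu_alpha.
have -> : [set w : config V | [set w' : config V | w' r = Plus] (fun i => flip (w i))] =
    [set w | w r = Minus].
  by apply/seteqP; split=> w /=; case: (w r).
by rewrite mu_alpha => -[].
Qed.

End InvariantLaw.

(** * A lower bound on the oscillation, uniform in [Lambda] *)

Theorem theorem2p8 (R : realType) (d s : nat) (hs : (d.+1 < 2 * s)%N) :
  exists beta_c : R, 0 < beta_c /\
  forall beta : R, beta_c < beta ->
  exists t_c : R, 0 < t_c /\
  forall (V : choiceType) (E : rel V), cayley_tree d E ->
  forall eta : config V, contains_rooted_tree s E (occupied eta) ->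
  forall t : R, t_c <= t ->
  forall lambda : R, 0 < lambda ->
  forall mu mu_t : probability (config V) R,
    intermediate_measure E d beta lambda mu -> time_evolved t mu mu_t ->
    essentially_discontinuous mu_t eta.
Proof.
(* By [expR beta >= 1 + beta], this choice gives [Q >= 2 ^ (s + 1)]. *)
exists (2 ^+ s.+1); split=> [|beta hb]; first by rewrite exprn_gt0.
(* For [t >= 1], [expR (2 * t) >= 1 + 2 * t >= 3], which is the bound on the field strength. *)
exists 1; split=> [//|V E].
move=> [[symE irrE conE acyE] _ degE].
have /choice [nbr nbrP] : forall x, exists N : {fset V}, #|` N| = d.+1 /\ N =i E x.
  by move=> x; have [N ? ?] := degE x; exists N.
move=> eta [T [r [[Tr _ Tk] Tocc]]] t t1 lambda _ mu mu_t.
move=> [_ mc _ fi [xi [xi0 _ tm [alpha ainv mual]]]] ev.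
have t0 : 0 < t by rewrite (lt_le_trans _ t1).
have beta0 : 0 < beta by rewrite (lt_trans _ hb) // exprn_gt0.
have Q_large : 2 ^+ s.+1 <= expR beta.
  by rewrite (le_trans _ (expR_ge1Dx _)) // (le_trans (ltW hb)) // lerDr.
have e0 := expR_gt0 (- (2 * t)); have e1 := decay_lt1 t0.
have e3 : 3 * expR (- (2 * t)) <= 1.
  rewrite expRN ler_pdivrMr ?expR_gt0 // mul1r (le_trans _ (expR_ge1Dx _)) //.
  by move: t1; lra.
have nbrE x y : (y \in nbr x) = E x y by have [_ /(_ y)] := nbrP x.
have card_nbr x : #|` nbr x| = d.+1 by have [] := nbrP x.
have s0 : (0 < s)%N by clear -hs; case: s hs.
have T_kids x : T x -> exists2 C : {fset V}, #|` C| = s &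
    (C `<=` kids conE r nbr x)%fset /\ forall y, y \in C -> T y.
  move=> Tx; have [C cC CP] := Tk x Tx; exists C => //; split=> [|y /CP[]//].
  by apply/fsubsetP => y /CP[_ Exy far]; exact: farther_kid.
(* A child of the root in [T] has only [d] children of its own, and [s] of them lie in [T]. *)
have sd : (s <= d)%N.
  have [C cC [Ck CT]] := T_kids r Tr.
  have [y yC] : exists y, y \in C by apply/fset0Pn; rewrite -cardfs_gt0 cC.
  have [C' cC' [Ck' _]] := T_kids y (CT _ yC).
  have := fsubset_leq_card Ck'; rewrite cC' (card_kids symE acyE conE r irrE nbrE (card_nbr y)).
  case: eqP => // yr; have := fsubsetP Ck _ yC.
  by rewrite yr (in_kids symE acyE conE r irrE nbrE) depth_root.
have agt0 := alpha_gt0 xi0 mual ainv r.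
have mu_gt0 i x : (0 < mu [set w : config V | w i = x])%E by rewrite mual lte_fin.
have [C C0 PC] := @transition_xi_comparable R beta xi xi0.
have [m rhoQ] := @expr_unbounded R ((1 + expR (- (2 * t))) / (1 - expR (- (2 * t)))) (expR beta)
  ltac:(by rewrite ltr_pdivlMr ?subr_gt0 // mul1r ltrD2l gtrN).
have alphaE b : b != Zero -> alpha b = alpha Plus.
  by case: b => // _; rewrite (alpha_flip mual r fi).
pose C' := C ^+ d.+1; have C'0 : 0 < C' by rewrite exprn_gt0.
pose f : config V -> R := fun w => spin_shift R (w r).
pose L n := tree_ball r nbr n.
(* The annulus starts at depth [n.+1]; [m] more layers give the innermost one the power [rho ^ m],
   which exceeds [Q]. The width [m] does not depend on [n]. *)
pose D n := tree_ball r nbr (n.+1 + m).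
have balls := in_ball symE acyE conE r irrE nbrE.
have LD n : (L n `<=` D n)%fset.
  by apply/fsubsetP => i; rewrite !balls => /leq_trans->//; rewrite addSnnS leq_addr.
(* [A x] is the unnormalized weight of the time-0 spin [x] at the root, given the evolved spins
   elsewhere in the ball. The third bound keeps the share of [b] away from 0, uniformly in [n]. *)
have key n b : b != Zero -> exists A : spin -> R,
    [/\ forall x, 0 < A x, 2 * A (flip b) <= A b,
        alpha Plus * (\sum_(x : spin) A x) <= C' * A b &
        elementary_cond_exp mu_t f (agree_on (L n `\ r)%fset eta `&`
          agree_on (D n `\` L n)%fset (fun=> b)) =
        1 + expR (- (2 * t)) * ((A Plus - A Minus) / \sum_(x : spin) A x)].
  move=> b0; pose zeta : config V := fun i => if i \in L n then eta i else b.
  have := @peel_root V E symE irrE acyE conE r nbr nbrE R beta xi beta0 xi0 b b0 d s T n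
    (n.+1 + m)%N t zeta C hs sd card_nbr Tr T_kids t0 e3 Q_large.
  rewrite addSn ltnS leq_addr subSS addKn => /(_ isT rhoQ).
  case=> //.
  - move=> i Ti ni; rewrite /zeta balls ni; have := Tocc _ Ti.
    by rewrite /occupied /=; case: (eta i).
  - by move=> i ni; rewrite /zeta balls leqNgt ni.
  set H := peel _ _ _ _ _ _ _ _ => H2 H0 HC.
  exists (fun x => H x * alpha x); split.
  - by move=> x; rewrite mulr_gt0.
  - by rewrite mulrA !alphaE ?flip_neq0 // ler_pM2r.
  (* The factor [alpha b] cancels; what remains is an average of [H] under [alpha], bounded by
     [C' * H b] through comparability. *)
  - rewrite -(alphaE _ b0) [leRHS]mulrA [leRHS]mulrC ler_pM2l //.
    rewrite -[leRHS]mulr1 -(alpha_sum1 mual r) mulr_sumr; apply: ler_sum => x _.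
    by rewrite ler_wpM2r ?HC // ltW.
  apply: etrans (evolved_magnetization _ (fun a => erefl)); last first.
    by rewrite big_spin !addr_gt0 // mulr_gt0.
  apply: elementary_cond_exp_coord.
  - by apply: measurableI; exact: measurable_agree_on.
  - by case=> /=.
  move=> a; apply: etrans
    (evolved_agree_on symE irrE acyE conE nbrE xi0 mc tm mu_gt0 zeta t0 (n.+1 + m) a (mual r) ev).
  congr (mu_t _); apply/seteqP; split=> w /=.
    move=> [[wL wD] wr] i iD; case: eqP => [->//|/eqP ir]; rewrite /zeta; case: ifPn => iL.
      by apply: wL; rewrite in_fsetD1 ir.
    by apply: wD; rewrite in_fsetD iL.
  move=> wD; split; first split.
  - move=> i; rewrite in_fsetD1 => /andP[ir iL].
    by rewrite (wD i (fsubsetP (LD n) _ iL)) (negbTE ir) /zeta iL.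
  - move=> i; rewrite in_fsetD => /andP[iL iD]; rewrite (wD i iD) /zeta (negbTE iL).
    case: eqP => // ir; move: iL; rewrite ir balls depth_root //.
  - by rewrite (wD r _) ?eqxx //; apply: (fsubsetP (LD n)); rewrite balls depth_root.
(* Twice the bound of [half], scaled by the decay: the two boundary signs contribute magnetizations
   of opposite sign. *)
pose c := expR (- (2 * t)) * (alpha Plus / C').
have c0 : 0 < c by rewrite mulr_gt0 // divr_gt0.
have half A b : (forall x, 0 < A x) -> 2 * A (flip b) <= A b ->
    alpha Plus * (\sum_(x : spin) A x) <= C' * A b ->
    alpha Plus / C' / 2 <= (A b - A (flip b)) / \sum_(x : spin) A x.
  move=> A0 A2 AC; have S0 : 0 < \sum_(x : spin) A x by rewrite big_spin !addr_gt0.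
  have : alpha Plus / C' * (\sum_(x : spin) A x) <= A b.
    by rewrite mulrAC ler_pdivrMr // [leRHS]mulrC.
  by rewrite ler_pdivlMr //; move: A2; clear; lra.
exists f, [fset r]%fset; split.
  exists [fset r]%fset => Y mY; exact: sigma_field_coord_fun.
apply: (@lt_le_trans _ _ c%:E); first by rewrite lte_fin.
apply/ereal_infP => _ [M _ <-].
(* A ball containing the given [M] is an admissible [Lambda], so [c] bounds the supremum for every
   [M]. *)
pose n := (\max_(i <- M) depth conE r i)%N.
have ML : (M `<=` L n)%fset.
  by apply/fsubsetP => i iM; rewrite /L balls /n (big_fsetD1 i) //= leq_maxl.
have [A1 [A10 A12 A1C cA1]] := key n Plus isT.
have [A2 [A20 A22 A2C cA2]] := key n Minus isT.
apply: (@le_trans _ _ (`|elementary_cond_exp mu_t f (agree_on (L n `\ r)%fset eta `&`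
          agree_on (D n `\` L n)%fset (fun=> Plus)) -
    elementary_cond_exp mu_t f (agree_on (L n `\ r)%fset eta `&`
          agree_on (D n `\` L n)%fset (fun=> Minus))|)%:E).
  rewrite lee_fin cA1 cA2; apply: le_trans (ler_norm _).
  have h1 := half A1 Plus A10 A12 A1C; have := half A2 Minus A20 A22 A2C.
  rewrite /= -opprB mulNr => h2; rewrite /c opprD addrACA subrr add0r -mulrBr ler_pM2l //.
  by move: h1 h2 => /=; clear; lra.
apply: le_trans; last by apply: ereal_sup_ubound; exists (L n).
by apply: ereal_sup_ubound; exists (fun=> Plus), (fun=> Minus), (D n).
Qed.
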